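(* Fix $t\in\mathbb{N}$. A matroid $M$ is a positroid if and only if $M^t$ is a positroid.
   Context: A cyclic flat of a matroid $M$ is a flat $F$ such that $M|F$ has no coloops; $\mathcal{Z}(M)$ denotes the set of cyclic flats, and a matroid is determined by its cyclic flats and their ranks. The $t$-expansion: for each $e\in E(M)$ let $S_e$ be a $t$-element set with $e\in S_e$, the sets $S_e$ pairwise disjoint; for $X\subseteq E(M)$ let $S_X=\bigcup_{e\in X}S_e$. The $t$-expansion $M^t$ is the matroid on $S_{E(M)}$ whose cyclic flats are exactly the sets $S_A$ with $A\in\mathcal{Z}(M)$, with $r_{M^t}(S_A)=t\cdot r_M(A)$. A positroid is a matroid $M$ of rank $r$ with $|E(M)|=m$ that is represented over $\mathbb{R}$ by an $r\times m$ matrix (with some linear ordering of $E(M)$ as columns) all of whose $r\times r$ submatrices formed by choosing $r$ columns have nonnegative determinant. *)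

(* Defs.v *)
From HB Require Import structures.
From mathcomp Require Import all_boot all_order all_algebra.
From mathcomp Require Import reals zify.

Set Implicit Arguments.
Unset Strict Implicit.
Unset Printing Implicit Defensive.

Import Order.TTheory GRing.Theory Num.Theory.

(* The ground set is a subset of an ambient finite type [T] rather than a      *)
(* type of its own, so that [M] and an expansion of it live in the same [T]    *)
(* and the requirement [e \in S e] makes sense literally.                      *)
Record matroid (T : finType) := Matroid {
  ground : {set T};
  indep : {set {set T}};
  indep_ground : forall I : {set T}, I \in indep -> I \subset ground;
  indep0 : set0 \in indep;
  indep_sub : forall I J : {set T}, J \in indep -> I \subset J -> I \in indep;
  indep_aug : forall I J : {set T}, I \in indep -> J \in indep -> #|I| < #|J| ->
    exists2 x, x \in J :\: I & x |: I \in indep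
}.

Section MatroidNotions.
Variables (T : finType) (M : matroid T).
Implicit Types (F X : {set T}) (e : T).

Definition rank X : nat := \max_(I in indep M | I \subset X) #|I|.

Definition basis (B : {set T}) : bool := maxset [in indep M] B.

Definition coloop e : bool :=
  (e \in ground M) && [forall B : {set T}, basis B ==> (e \in B)].

Definition flat F : bool :=
  (F \subset ground M) && [forall x in ground M :\: F, rank F < rank (x |: F)].

Section Restriction.
Variable X : {set T}.

Let rground := ground M :&: X.
Let rindep := [set I in indep M | I \subset X].

Fact restrict_ground I : I \in rindep -> I \subset rground.
Proof. by rewrite inE subsetI => /andP[/indep_ground-> ->]. Qed.

Fact restrict0 : set0 \in rindep.
Proof. by rewrite inE indep0 sub0set. Qed.

Fact restrict_sub (I J : {set T}) : J \in rindep -> I \subset J -> I \in rindep.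
Proof.
rewrite !inE => /andP[JM JX] IJ.
by rewrite (indep_sub JM IJ) (subset_trans IJ JX).
Qed.

Fact restrict_aug (I J : {set T}) : I \in rindep -> J \in rindep -> #|I| < #|J| ->
  exists2 x, x \in J :\: I & x |: I \in rindep.
Proof.
rewrite !inE => /andP[IM IX] /andP[JM JX] ltIJ.
have [x xJI xIM] := indep_aug IM JM ltIJ; exists x => //.
by rewrite inE xIM subUset sub1set IX (subsetP JX) //; case/setDP: xJI.
Qed.

Definition restrict : matroid T :=
  Matroid restrict_ground restrict0 restrict_sub restrict_aug.

End Restriction.
End MatroidNotions.

Definition cyclic_flat (T : finType) (M : matroid T) (F : {set T}) : Prop :=
  flat M F /\ forall e : T, ~~ coloop (restrict M F) e.

Definition blow_up (T : finType) (S : T -> {set T}) (X : {set T}) : {set T} :=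
  \bigcup_(e in X) S e.

Definition expansion_blocks (T : finType) (t : nat) (E : {set T})
    (S : T -> {set T}) : Prop :=
  [/\ {in E, forall e, e \in S e},
      {in E, forall e, #|S e| = t} &
      {in E &, forall e f, e != f -> [disjoint S e & S f]}].

Definition is_expansion (T : finType) (t : nat) (S : T -> {set T})
    (M N : matroid T) : Prop :=
  [/\ ground N = blow_up S (ground M),
      forall F : {set T}, cyclic_flat N F <->
        exists2 A : {set T}, cyclic_flat M A & F = blow_up S A &
      forall A : {set T}, cyclic_flat M A ->
        rank N (blow_up S A) = t * rank M A].

Section RankTheory.
Variables (T : finType) (M : matroid T).
Implicit Types (I J X Y B : {set T}) (e x : T).

Lemma card_le_rank I X : I \in indep M -> I \subset X -> #|I| <= rank M X.
Proof.
move=> IM IX; rewrite /rank.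
have := @bigop.leq_bigmax_cond {set T}
  (fun I => (I \in indep M) && (I \subset X)) (fun I => #|I|) I.
by rewrite IM IX; apply.
Qed.

Lemma rank_witness X : exists I, [/\ I \in indep M, I \subset X & rank M X = #|I|].
Proof.
have P0 : (set0 \in indep M) && (set0 \subset X) by rewrite indep0 sub0set.
rewrite /rank (bigop.bigmax_eq_arg set0) //; case: arg_maxnP => // I /andP[IM IX] _.
by exists I.
Qed.

Lemma rankS X Y : X \subset Y -> rank M X <= rank M Y.
Proof.
move=> XY; have [I [IM IX ->]] := rank_witness X.
exact: card_le_rank IM (subset_trans IX XY).
Qed.

Lemma indep_extend I X : I \in indep M -> I \subset X ->
  exists J, [/\ J \in indep M, I \subset J, J \subset X & #|J| = rank M X].
Proof.
move=> IM IX.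
have [n] := ubnP (rank M X - #|I|); elim: n I IM IX => // n IHn I IM IX ltn_.
have [leXI|ltIX] := leqP (rank M X) #|I|.
  exists I; split=> //; apply/eqP.
  by rewrite eqn_leq leXI card_le_rank.
have [J [JM JX eJ]] := rank_witness X.
have [|x /setDP[xJ xI] xIM] := indep_aug IM JM; first by rewrite -eJ.
have xIX : x |: I \subset X by rewrite subUset sub1set (subsetP JX).
have [|K [KM xIK KX eK]] := IHn _ xIM xIX.
  by rewrite cardsU1 xI /=; lia.
by exists K; split=> //; apply: subset_trans xIK; apply: subsetUr.
Qed.

Lemma rank_submod X Y : rank M (X :|: Y) + rank M (X :&: Y) <= rank M X + rank M Y.
Proof.
have [I [IM IXY eI]] := rank_witness (X :&: Y).
have IXuY : I \subset X :|: Y.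
  by apply: subset_trans IXY _; apply: subset_trans (subsetIl _ _) (subsetUl _ _).
have [J [JM IJ JXY eJ]] := indep_extend IM IXuY.
have le1 : #|J :&: X| <= rank M X.
  by apply: card_le_rank (subsetIr _ _); apply: indep_sub JM (subsetIl _ _).
have le2 : #|J :&: Y| <= rank M Y.
  by apply: card_le_rank (subsetIr _ _); apply: indep_sub JM (subsetIl _ _).
have := cardsUI (J :&: X) (J :&: Y).
rewrite -setIUr (setIidPl JXY) => e1.
have : #|I| <= #|J :&: X :&: (J :&: Y)|.
  apply: subset_leq_card; rewrite !subsetI IJ /=.
  by move: IXY; rewrite subsetI => /andP[-> ->].
lia.
Qed.

Lemma rank_le_card X : rank M X <= #|X|.
Proof. by have [I [_ IX ->]] := rank_witness X; apply: subset_leq_card. Qed.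

Lemma rankU_le X Y : rank M (X :|: Y) <= rank M X + #|Y :\: X|.
Proof.
have -> : X :|: Y = X :|: (Y :\: X).
  by apply/setP => x; rewrite !inE; case: (x \in X).
have := rank_submod X (Y :\: X); have := rank_le_card (Y :\: X); lia.
Qed.

Lemma coloop_restrictE X e : X \subset ground M ->
  coloop (restrict M X) e = (e \in X) && (rank M (X :\ e) < rank M X).
Proof.
move=> XE; rewrite /coloop /= inE.
case eX: (e \in X); last by rewrite andbF.
rewrite (subsetP XE) //=; apply/idP/idP.
  move/forallP => H; have [I [IM IXe eI]] := rank_witness (X :\ e).
  have IX : I \subset X by apply: subset_trans IXe (subsetDl _ _).
  rewrite ltn_neqAle rankS ?subsetDl // andbT; apply/eqP => er.
  have /implyP/(_ _)/(subsetP IXe) := H I; rewrite !inE eqxx /= => /(_ _)/notF.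
  apply; apply/maxsetP; split; first by rewrite /= !inE IM.
  move=> J; rewrite /= !inE => /andP[JM JX] IJ.
  apply/esym/eqP; rewrite eqEcard IJ -eI er /=; exact: card_le_rank.
move=> lt; apply/forallP => B; apply/implyP => /maxsetP[].
rewrite /= !inE => /andP[BM BX] Bmax; apply/negPn/negP => eB.
have BXe : B \subset X :\ e by rewrite subsetD1 BX eB.
have [J [JM BJ JX eJ]] := indep_extend BM BX.
have /Bmax/(_ BJ) JB : J \in [in indep (restrict M X)] by rewrite /= !inE JM JX.
have := card_le_rank BM BXe; rewrite -JB eJ; lia.
Qed.

End RankTheory.

Section ExpansionExists.
Variables (T : finType) (t : nat) (M : matroid T) (S : T -> {set T}).
Hypothesis hS : expansion_blocks t (ground M) S.
Local Notation E := (ground M).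
Local Notation "'S_' X" := (blow_up S X) (at level 8, X at level 2).
Implicit Types (A B I J X Y : {set T}).

Let blow_upP X y : reflect (exists2 e, e \in X & y \in S e) (y \in S_ X).
Proof. exact: bigcupP. Qed.

Let block_eq e f y : e \in E -> f \in E -> y \in S e -> y \in S f -> e = f.
Proof.
move=> eE fE ye yf; apply/eqP/negPn/negP => nef.
have [_ _ dS] := hS.
by have /pred0P/(_ y)/= := dS e f eE fE nef; rewrite ye yf.
Qed.

Let mem_blow_up A e y : A \subset E -> e \in E -> y \in S e ->
  (y \in S_ A) = (e \in A).
Proof.
move=> AE eE ye; apply/blow_upP/idP => [[f fA yf]|eA]; last by exists e.
by rewrite (block_eq eE (subsetP AE f fA) ye yf).
Qed.

Let blow_upU A B : S_ (A :|: B) = S_ A :|: S_ B.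
Proof. by rewrite /blow_up bigcup_setU. Qed.

Let blow_upI A B : A \subset E -> B \subset E -> S_ (A :&: B) = S_ A :&: S_ B.
Proof.
move=> AE BE; apply/setP => y; rewrite inE; apply/blow_upP/andP.
  by case=> e /setIP[eA eB] ye; split; apply/blow_upP; exists e.
case=> /blow_upP[e eA ye] /blow_upP[f fB yf].
have ef := block_eq (subsetP AE e eA) (subsetP BE f fB) ye yf.
by exists e => //; rewrite inE eA ef.
Qed.

Let blow_upD A B : A \subset E -> B \subset E -> S_ (A :\: B) = S_ A :\: S_ B.
Proof.
move=> AE BE; apply/setP => y; rewrite inE; apply/blow_upP/andP.
  case=> e /setDP[eA eB] ye; split; last by apply/blow_upP; exists e.
  by rewrite (mem_blow_up BE (subsetP AE e eA) ye).
case=> yB /blow_upP[e eA ye]; exists e => //; rewrite inE eA andbT.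
by rewrite -(mem_blow_up BE (subsetP AE e eA) ye).
Qed.

Let blow_upS A B : A \subset B -> S_ A \subset S_ B.
Proof.
move=> AB; apply/subsetP => y /blow_upP[e eA ye].
by apply/blow_upP; exists e => //; apply: (subsetP AB).
Qed.

Let card_blow_up A : A \subset E -> #|S_ A| = t * #|A|.
Proof.
have [_ cS _] := hS.
have [n] := ubnP #|A|; elim: n A => // n IHn A ltA AE.
have [->|[e eA]] := set_0Vmem A; first by rewrite /blow_up big_set0 !cards0 muln0.
have AeE : A :\ e \subset E by apply: subset_trans (subsetDl _ _) AE.
have eE := subsetP AE e eA.
have se : S_ [set e] = S e by rewrite /blow_up big_set1.
have := cardsID (S_ [set e]) (S_ A).
rewrite -blow_upD ?sub1set // (setIidPr _); last by apply: blow_upS; rewrite sub1set.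
rewrite se (cS e eE) => <-.
have cA := cardsD1 e A; rewrite eA in cA.
by rewrite IHn ?cA ?mulnDr ?muln1 //; lia.
Qed.

Let eindep := [set I : {set T} | (I \subset S_ E) &&
  [forall A : {set T}, (A \subset E) ==> (#|I :&: S_ A| <= t * rank M A)]].

Let eindepP I : reflect
  (I \subset S_ E /\ forall A, A \subset E -> #|I :&: S_ A| <= t * rank M A)
  (I \in eindep).
Proof.
rewrite inE; apply: (iffP andP) => -[IE H]; split=> //.
  by move=> A AE; have /forallP/(_ A)/implyP/(_ AE) := H.
by apply/forallP => A; apply/implyP; apply: H.
Qed.

Let tight I A := (A \subset E) && (#|I :&: S_ A| == t * rank M A).

Let tightU I A B : I \in eindep -> tight I A -> tight I B -> tight I (A :|: B).
Proof.
move=> /eindepP[IE Ile] /andP[AE /eqP eA] /andP[BE /eqP eB].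
have ABE : A :|: B \subset E by rewrite subUset AE.
rewrite /tight ABE /= eqn_leq Ile //=.
have := cardsUI (I :&: S_ A) (I :&: S_ B).
rewrite -setIUr -blow_upU eA eB.
have -> : I :&: S_ A :&: (I :&: S_ B) = I :&: S_ (A :&: B).
  by rewrite blow_upI // setIACA setIid.
have := Ile (A :&: B) (subset_trans (subsetIl _ _) AE).
have := leq_mul (leqnn t) (rank_submod M A B); rewrite !mulnDr; lia.
Qed.

(* If no element of Y extends the independent set X, some tight set covers Y.  *)
Let tight_cover X Y : X \in eindep -> Y \subset S_ E ->
  (forall y, y \in Y :\: X -> y |: X \notin eindep) ->
  exists2 A : {set T}, tight X A & Y :\: X \subset S_ A.
Proof.
move=> XI YE noext.
pose A := \bigcup_(B : {set T} | tight X B) B.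
have tA : tight X A.
  rewrite /A; elim/big_rec: _ => [|B C tB tC]; last exact: tightU.
  rewrite /tight sub0set /=.
  have := rank_le_card M set0; rewrite cards0 leqn0 => /eqP->.
  by rewrite /blow_up big_set0 setI0 cards0 muln0.
exists A => //; apply/subsetP => y yYX; move: (noext y yYX).
have /setDP[yY yX] := yYX; have /eindepP[XE Xle] := XI.
rewrite inE subUset sub1set (subsetP YE) // XE /= negb_forall => /existsP[B].
rewrite negb_imply -ltnNge => /andP[BE lt].
have leB := Xle B BE.
have yB : y \in S_ B.
  apply/negPn/negP => yB; move: lt; rewrite setIUl.
  have -> : [set y] :&: S_ B = set0.
    by apply/setP => z; rewrite !inE; case: eqP => // ->; apply: negbTE.
  by rewrite set0U ltnNge leB.
apply/(subsetP _ _ yB)/blow_upS/(bigcup_sup B).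
rewrite /tight BE /= eqn_leq leB /=.
have := leq_trans lt (subset_leq_card (_ : _ \subset y |: (X :&: S_ B))).
rewrite setIUl cardsU1 => /(_ (setSU _ (subsetIl _ _))).
by case: (_ \notin _) => /=; lia.
Qed.

Let e_ground I : I \in eindep -> I \subset S_ E.
Proof. by case/eindepP. Qed.

Let e_indep0 : set0 \in eindep.
Proof. by apply/eindepP; split=> [|A _]; rewrite ?sub0set // set0I cards0. Qed.

Let e_sub I J : J \in eindep -> I \subset J -> I \in eindep.
Proof.
move=> /eindepP[JE Jle] IJ; apply/eindepP; split; first exact: subset_trans JE.
by move=> A AE; apply: leq_trans (Jle A AE); apply: subset_leq_card; apply: setSI.
Qed.

Let e_aug I J : I \in eindep -> J \in eindep -> #|I| < #|J| ->
  exists2 x, x \in J :\: I & x |: I \in eindep.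
Proof.
move=> II JI lt; have [JE Jle] := eindepP _ JI.
case: (pickP [pred x | (x \in J :\: I) && (x |: I \in eindep)]) => [x /andP[]|no].
  by exists x.
have [|A /andP[AE /eqP eA] cov] := tight_cover II JE.
  by move=> y yJI; have := no y; rewrite /= yJI /= => ->.
have := Jle A AE; rewrite -eA => leA.
have : #|J :\: S_ A| <= #|I :\: S_ A|.
  apply: subset_leq_card; apply/subsetP => y /setDP[yJ yA]; rewrite inE yA /=.
  apply/negPn/negP => yI; move/negP: yA; apply; apply: (subsetP cov).
  by rewrite inE yI.
have := cardsID (S_ A) J; have := cardsID (S_ A) I; lia.
Qed.

Let N := Matroid e_ground e_indep0 e_sub e_aug.

Let rank_le X A : X \subset S_ E -> A \subset E ->
  rank N X <= t * rank M A + #|X :\: S_ A|.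
Proof.
move=> XE AE; have [I [IN IX ->]] := rank_witness N X.
have [_ /(_ A AE) Ile] := eindepP _ IN.
rewrite -(cardsID (S_ A) I); apply: leq_add => //.
by apply: subset_leq_card; apply: setSD.
Qed.

Let rank_eq X : X \subset S_ E -> exists2 A : {set T}, A \subset E &
  rank N X = t * rank M A + #|X :\: S_ A|.
Proof.
move=> XE; have [I [IN IX eI]] := rank_witness N X.
have [|A /andP[AE /eqP eA] cov] := tight_cover IN XE.
  move=> y /setDP[yX yI]; apply/negP => yIN.
  have := @card_le_rank _ N (y |: I) X yIN.
  by rewrite subUset sub1set yX IX cardsU1 yI eI => /(_ isT); rewrite ltnn.
exists A => //; apply/eqP; rewrite eqn_leq rank_le //= eI -(cardsID (S_ A) I) eA.
rewrite leq_add2l; apply: subset_leq_card; apply/subsetP => y /setDP[yX yA].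
rewrite inE yA /=; apply/negPn/negP => yI; move/negP: yA; apply.
by apply: (subsetP cov); rewrite inE yI.
Qed.

Let rankN_blow_up A : A \subset E -> rank N (S_ A) = t * rank M A.
Proof.
move=> AE; apply/eqP; rewrite eqn_leq; apply/andP; split.
  by have := rank_le (blow_upS AE) AE; rewrite setDv cards0 addn0.
have [B BE ->] := rank_eq (blow_upS AE).
rewrite -blow_upD // card_blow_up; last by apply: subset_trans (subsetDl _ _) AE.
rewrite -mulnDr leq_mul //.
by apply: leq_trans (rankU_le M B A); apply: rankS; apply: subsetUr.
Qed.

Let t_gt0 e : e \in E -> 0 < t.
Proof.
have [mS cS _] := hS => eE; rewrite -(cS e eE).
by apply/card_gt0P; exists e; apply: mS.
Qed.

Let flatN_sub F : cyclic_flat N F ->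
  exists2 A : {set T}, cyclic_flat M A & F = S_ A.
Proof.
case=> /andP[FE /forallP flF] ncF.
have [A AE eF] := rank_eq FE.
have FA : F \subset S_ A.
  apply/subsetP => y yF; apply/negPn/negP => yA.
  have /negP := ncF y; apply; rewrite coloop_restrictE // eF yF /=.
  have := rank_le (subset_trans (subsetDl F [set y]) FE) AE.
  have := cardsD1 y (F :\: S_ A); rewrite !inE yF yA /=.
  by rewrite setDDl setUC -setDDl [F :\ y :\: _]setDDl setUC -setDDl; lia.
have eFA : F = S_ A.
  apply/eqP; rewrite eqEsubset FA /=; apply/subsetP => y yA.
  apply/negPn/negP => yF; have /implyP := flF y.
  rewrite inE yF /= (subsetP (blow_upS AE) y yA) => /(_ isT).
  rewrite ltnNge => /negP; apply.
  apply: leq_trans (rankS N (_ : _ \subset S_ A)) _.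
    by rewrite subUset sub1set yA.
  by rewrite rankN_blow_up // eF leq_addr.
exists A => //; split.
  rewrite /flat AE; apply/forallP => x; apply/implyP => /setDP[xE xA].
  have [mS _ _] := hS; have xx := mS x xE.
  have /implyP := flF x; rewrite inE eFA (mem_blow_up AE xE xx) xA /=.
  move=> /(_ (subsetP (blow_upS (_ : [set x] \subset E)) x _)).
  rewrite sub1set xE (mem_blow_up _ xE xx) ?sub1set ?set11 // => /(_ isT isT) lt.
  have xAE : x |: A \subset E by rewrite subUset sub1set xE.
  have /leq_trans/(_ (rankS N (_ : _ \subset S_ (x |: A)))) := lt.
  rewrite blow_upU setSU; last first.
    by rewrite sub1set; apply/blow_upP; exists x; rewrite ?set11.
  by move=> /(_ isT); rewrite -blow_upU !rankN_blow_up // ltn_mul2l => /andP[].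
move=> x; apply/negP; rewrite coloop_restrictE // => /andP[xA lt].
have xE := subsetP AE x xA.
have [mS cS _] := hS; have xx := mS x xE.
have /negP := ncF x; apply; rewrite coloop_restrictE // eFA.
rewrite (mem_blow_up AE xE xx) xA /= rankN_blow_up //.
have AxE : A :\ x \subset E by apply: subset_trans (subsetDl _ _) AE.
have := @rank_le (S_ A :\ x) (A :\ x) (subset_trans (subsetDl _ _) (blow_upS AE)) AxE.
have : #|S_ A :\ x :\: S_ (A :\ x)| < t.
  rewrite -(cS x xE) (cardsD1 x (S x)) xx ltnS; apply: subset_leq_card.
  apply/subsetP => y /setDP[/setD1P[yx /blow_upP[e eA ye]] yAx].
  rewrite !inE yx /=; case: (eqVneq e x) => [<- //|nex].
  by move/negP: yAx; case; apply/blow_upP; exists e; rewrite // !inE nex.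
have := leq_mul (leqnn t) lt; rewrite mulnS; lia.
Qed.

Let sub_flatN A : cyclic_flat M A -> cyclic_flat N (S_ A).
Proof.
case=> /andP[AE /forallP flA] ncA; have SAE := blow_upS AE; split.
  rewrite /flat SAE; apply/forallP => y; apply/implyP => /setDP[yE yA].
  have /blow_upP[x xE yx] := yE; have t0 := t_gt0 xE.
  have xA : x \notin A by rewrite -(mem_blow_up AE xE yx).
  have yAE : y |: S_ A \subset S_ E by rewrite subUset sub1set yE.
  rewrite rankN_blow_up //; have [B BE ->] := rank_eq yAE.
  have ADE : A :\: B \subset E by apply: subset_trans (subsetDl _ _) AE.
  have /(leq_mul (leqnn t)) le := rankU_le M B A.
  case xB: (x \in B).
    have ltA : rank M A < rank M (x |: A).
      by have /implyP := flA x; rewrite inE xA xE => /(_ isT).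
    have /(leq_mul (leqnn t)) : rank M (x |: A) <= rank M (B :|: A).
      by apply: rankS; rewrite setSU // sub1set.
    have : #|S_ (A :\: B)| <= #|(y |: S_ A) :\: S_ B|.
      by rewrite blow_upD //; apply: subset_leq_card; apply: setSD; apply: subsetUr.
    rewrite card_blow_up //; have := leq_mul (leqnn t) ltA.
    by move: le; rewrite mulnS mulnDr; lia.
  have /(leq_mul (leqnn t)) : rank M A <= rank M (B :|: A) by apply/rankS/subsetUr.
  have : #|S_ (A :\: B)| < #|(y |: S_ A) :\: S_ B|.
    have yB : y \notin S_ B by rewrite (mem_blow_up BE xE yx) xB.
    rewrite (cardsD1 y (_ :\: _)) !inE eqxx yB /= add1n ltnS blow_upD //.
    apply: subset_leq_card; apply/subsetP => z /setDP[zA zB].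
    rewrite !inE zA zB orbT /= andbT; apply: contraNneq yA => <- //.
  by rewrite card_blow_up //; move: le; rewrite mulnDr; lia.
move=> y; apply/negP; rewrite coloop_restrictE // => /andP[yA].
have /blow_upP[x xA yx] := yA; have xE := subsetP AE x xA; have t0 := t_gt0 xE.
rewrite rankN_blow_up // ltnNge => /negP; apply.
have [B BE ->] := rank_eq (subset_trans (subsetDl (S_ A) [set y]) SAE).
have ADE : A :\: B \subset E by apply: subset_trans (subsetDl _ _) AE.
have eD : S_ A :\ y :\: S_ B = S_ (A :\: B) :\ y.
  by rewrite blow_upD // !setDDl setUC.
have := cardsD1 y (S_ (A :\: B)); rewrite -eD card_blow_up //.
rewrite (mem_blow_up ADE xE yx) inE xA andbT.
case xB: (x \in B) => /=.
  have /(leq_mul (leqnn t)) := rankU_le M B A.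
  have /(leq_mul (leqnn t)) : rank M A <= rank M (B :|: A) by apply/rankS/subsetUr.
  by rewrite mulnDr; lia.
have rA : rank M A <= rank M (A :\ x).
  by have := ncA x; rewrite coloop_restrictE // xA /= -leqNgt.
have /(leq_mul (leqnn t)) := rankU_le M B (A :\ x).
have /(leq_mul (leqnn t)) := leq_trans rA (rankS M (subsetUr B (A :\ x))).
have -> : A :\ x :\: B = (A :\: B) :\ x by rewrite !setDDl setUC.
have := cardsD1 x (A :\: B); rewrite !inE xA xB /= => ->.
by rewrite !mulnDr muln1; lia.
Qed.

(* The expansion exists for any choice of blocks, so [is_expansion] is never   *)
(* an unsatisfiable hypothesis.                                                *)
Lemma expansion_exists : exists N, is_expansion t S M N.
Proof.
exists N; split=> //.
  move=> F; split; first exact: flatN_sub.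
  by case=> A cA ->; apply: sub_flatN.
by move=> A [/andP[AE _] _]; apply: rankN_blow_up.
Qed.

End ExpansionExists.

Local Open Scope ring_scope.

(* [s] is the linear ordering of the ground set: column [j] represents [s j].  *)
Definition represents (R : realType) (T : finType) (M : matroid T) (r m : nat)
    (s : 'I_m -> T) (A : 'M[R]_(r, m)) : Prop :=
  forall J : {set 'I_m},
    (s @: J \in indep M) = free [seq col j A | j <- enum J].

Definition nonneg_max_minors (R : realType) (r m : nat) (A : 'M[R]_(r, m)) : Prop :=
  forall f : 'I_r -> 'I_m, {homo f : i j / (i < j)%N} -> 0 <= \det (colsub f A).

Definition positroid (R : realType) (T : finType) (M : matroid T) : Prop :=
  exists (s : 'I_#|ground M| -> T) (A : 'M[R]_(rank M (ground M), #|ground M|)),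
    [/\ injective s, s @: setT = ground M, represents M s A & nonneg_max_minors A].

(* Main.v *)
Require Import Defs.
From mathcomp Require Import all_boot all_order all_algebra.
From mathcomp Require Import reals.
From mathcomp Require Import fingroup perm.
From mathcomp Require Import zify ring lra.

(* Order the ground set by an injective [p].  The rank-two obstruction to      *)
(* total nonnegativity is a minor on four elements in which [a] and [c] are    *)
(* parallel while [b] and [d], not parallel to [a], separate them cyclically;  *)
(* [noncrossing M p] forbids it.                                               *)
(* - The signs of the minors rule the obstruction out in a positroid.          *)
(* - It is inherited both ways between [M] and its [t]-expansion [N]: a set is *)
(*   independent in [N] iff it meets each [S_A] in at most [t * r(A)] elements,*)
(*   and a violated bound in [N] gives a set [A] such that [a, c] are          *)
(*   connected in [M|A] and [b, d] are connected in [M/A].                     *)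
(* - In a noncrossing matroid, the gaps of a circuit [C] are skew in [M/C], so *)
(*   the bases are the [r]-sets obeying the rank bounds of cyclic intervals.   *)
(* - Any rank function on cyclic intervals is realized by a nonnegative        *)
(*   matrix: delete a loop or a coloop, or else undo a bridge (adding column   *)
(*   [i] to column [i + 1]), which strictly decreases the rank function.       *)

Set Implicit Arguments.
Unset Strict Implicit.
Unset Printing Implicit Defensive.

Import Order.TTheory GRing.Theory Num.Theory.

(** * Rank functions and parallel pairs *)

(** Being a positroid is equivalent to having a noncrossing injective order on the ground set
    ([positroid_noncrossing], [noncrossing_positroid]), so it suffices to carry such an order across
    the expansion in both directions ([noncrossing_expansion], [noncrossing_of_expansion]).

    From [M] to [N], the blocks are made consecutive. A dependent set in a rank-two configuration of
    [N] breaks the bound of some [A]; comparison with the three bases puts the blocks of [a] and [c]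
    inside [A] and those of [b] and [d] outside, with no slack left. The same count excludes any
    separation of [a] from [c] in [M|A] and of [b] from [d] in [M/A]. Connected elements become
    parallel in a suitable minor ([parallel_of_connected]), and two parallel pairs over nested sets
    fit into one rank-two minor of [M] ([noncrossing_parallel]). From [N] to [M], a configuration of
    [M] is inflated: its common set is replaced by the blow-up of a base less two elements.

    A totally nonnegative matrix is noncrossing because, once [a] and [b] are unit vectors, the
    minors on [ab], [ad], [cb] and [cd] determine the sides on which [b] and [d] lie
    ([tnn_noncrossing]).

    Conversely, let [B] have [r(E)] elements, obey all interval bounds and contain a circuit [C].
    The complement of a gap of [C] is an interval and the gap is skew to the rest over [C], so [B]
    has at least [r(gap u C) - r(C)] elements in each gap. Summing gives [|B - C| >= r(E) - r(C)],
    hence [|B| > r(E)], which is absurd ([indep_of_cint]). The interval ranks thus determine the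
    bases, and [cyclic_rank_realizable] builds a matrix whose maximal minors are nonnegative and
    nonzero exactly there. *)

Ltac set_cases z := rewrite !inE;
  repeat match goal with
  | |- context [z \in ?A] => generalize (z \in A); case
  | |- context [z == ?y] => generalize (z == y); case
  end; done.
Ltac set_tauto := let z := fresh "z" in apply/setP => z; set_cases z.
Ltac set_sub := let z := fresh "z" in apply/subsetP => z; set_cases z.

Section RankExtra.
Variables (T : finType) (M : matroid T).
Implicit Types (I J X Y Z S F : {set T}) (a b c d e x y : T).
Local Notation r := (rank M).

Lemma rank_indep I : I \in indep M -> r I = #|I|.
Proof.
by move=> IM; apply/eqP; rewrite eqn_leq rank_le_card card_le_rank.
Qed.

Lemma indep_rank X : #|X| <= r X -> X \in indep M.
Proof.
have [I [IM IX ->]] := rank_witness M X => le.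
by have /eqP <- : I == X by rewrite eqEcard IX.
Qed.

Lemma rank0 : r set0 = 0.
Proof. by rewrite rank_indep ?indep0 // cards0. Qed.

Lemma rankU1_le x X : r (x |: X) <= (r X).+1.
Proof.
have := rankU_le M X [set x]; rewrite setUC.
have := subset_leq_card (subsetDl [set x] X); rewrite cards1; lia.
Qed.

Lemma leq_rankU1 x X : r X <= r (x |: X).
Proof. exact/rankS/subsetUr. Qed.

Lemma rank_spanU X Y Z : X \subset Y -> r X = r Y -> r (X :|: Z) = r (Y :|: Z).
Proof.
move=> XY eXY; apply/eqP; rewrite eqn_leq rankS ?setSU //=.
have := rank_submod M (X :|: Z) Y.
have -> : X :|: Z :|: Y = Y :|: Z.
  by rewrite setUAC (setUidPr XY).
have := rankS M (_ : X \subset (X :|: Z) :&: Y).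
rewrite subsetI XY subsetUl => /(_ isT); lia.
Qed.

Lemma rank_closureS x X Y : X \subset Y -> r (x |: X) = r X -> r (x |: Y) = r Y.
Proof.
move=> XY e; have := @rank_spanU X (x |: X) Y (subsetUr _ _) (esym e).
by rewrite -setUA (setUidPr XY).
Qed.

(** In the contraction of [S], both [x] and [y] are nonloops and they are parallel, possibly
    equal. *)
Definition parallel_over S x y : Prop :=
  [/\ r (x |: S) = (r S).+1, r (y |: S) = (r S).+1
    & r (x |: (y |: S)) = (r S).+1].

(* Chain rule for I(K; Y | S) = r(K u S) + r(Y u S) - r(K u Y u S) - r(S).     *)
Lemma skew_chain_left K Y S :
  r (K :|: Y :|: S) + r S < r (K :|: S) + r (Y :|: S) ->
  exists2 b, b \in K & exists S', [/\ S \subset S', S' \subset K :|: S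
    & r (b |: (Y :|: S')) + r S' < r (b |: S') + r (Y :|: S')].
Proof.
have [n] := ubnP #|K|; elim: n K => // n IHn K ltK lt.
have [K0|[b bK]] := set_0Vmem K.
  by move: lt; rewrite K0 !set0U; lia.
have cK := cardsD1 b K; rewrite bK in cK.
have eK : K = b |: (K :\ b) by rewrite setD1K.
set K1 := K :\ b in cK eK.
have [lt1|ge1] := ltnP (r (K1 :|: Y :|: S) + r S) (r (K1 :|: S) + r (Y :|: S)).
  have [|b' b'K [S' [SS' S'K lt']]] := IHn K1 _ lt1; first by lia.
  exists b'; first by rewrite eK inE b'K orbT.
  exists S'; split=> //; apply: subset_trans S'K _.
  by rewrite setSU // subsetDl.
exists b => //; exists (K1 :|: S); split; first exact: subsetUr.
  by rewrite setSU // subsetDl.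
have -> : b |: (Y :|: (K1 :|: S)) = K :|: Y :|: S by rewrite eK; set_tauto.
have -> : b |: (K1 :|: S) = K :|: S by rewrite eK; set_tauto.
have -> : Y :|: (K1 :|: S) = K1 :|: Y :|: S by set_tauto.
by lia.
Qed.

(** The chain rule, used on each side in turn, shrinks [K] and [Y] to single elements at the cost of
    enlarging the contracted set; two single elements with positive local connectivity are parallel
    nonloops. *)
Lemma parallel_of_not_skew K Y S :
  r (K :|: Y :|: S) + r S < r (K :|: S) + r (Y :|: S) ->
  exists b d, [/\ b \in K, d \in Y & exists S', [/\ S \subset S',
    S' \subset K :|: Y :|: S & parallel_over S' b d]].
Proof.
move=> /skew_chain_left[b bK [S1 [SS1 S1K lt1]]].
have [|d dY [S2 [S12 S2Y lt2]]] := @skew_chain_left Y [set b] S1.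
  by rewrite (setUC Y) -setUA; lia.
exists b, d; split=> //; exists S2; split; first exact: subset_trans SS1 S12.
  apply: subset_trans S2Y _; rewrite -setUA setUCA setUS //.
move: lt2; rewrite setUCA => lt2.
have := rankU1_le b S2; have := rankU1_le d S2.
have := rankS M (setUS [set b] (subsetUr [set d] S2)).
have := rankS M (subsetUr [set b] (d |: S2)).
split; lia.
Qed.

(* Tutte: if both deleting and contracting [e] separated [a] from [c], the two *)
(* separators would uncross to one in [F].                                     *)
Lemma parallel_of_connected S F a c : a \in F -> c \in F -> a != c ->
  (forall X, X \subset F -> a \in X -> c \notin X ->
     r (F :|: S) + r S < r (X :|: S) + r ((F :\: X) :|: S)) ->
  exists S', [/\ S \subset S', S' \subset F :|: S & parallel_over S' a c].
Proof.
have [n] := ubnP #|F|; elim: n F S => // n IHn F S ltF aF cF nac conn.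
have [F2|[e eF]] := set_0Vmem (F :\: [set a; c]).
  have eF : F = [set a; c].
    apply/eqP; rewrite eqEsubset -setD_eq0 F2 eqxx /=.
    by apply/subsetP => z; rewrite !inE => /orP[] /eqP->.
  have := conn [set a]; rewrite sub1set aF !inE eqxx eq_sym nac => /(_ isT isT isT).
  have -> : F :\: [set a] = [set c].
    rewrite eF; apply/setP => z; rewrite !inE; case: (z =P a) => //= ->.
    by rewrite (negbTE nac).
  rewrite eF -setUA => lt.
  have := rankU1_le a S; have := rankU1_le c S.
  have := rankS M (setUS [set a] (subsetUr [set c] S)).
  have := rankS M (subsetUr [set a] (c |: S)).
  move=> ? ? ? ?; exists S; split=> //; first by rewrite setUA subsetUr.
  by split; lia.
move: eF; rewrite !inE negb_or => /andP[/andP[nea nec] eF].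
set F1 := F :\ e.
have cF1 := cardsD1 e F; rewrite eF -/F1 in cF1.
have ltF1 : #|F1| < n by move: ltF cF1; clear; lia.
have aF1 : a \in F1 by rewrite !inE eq_sym nea.
have cF1' : c \in F1 by rewrite !inE eq_sym nec.
(* [bad S' X]: the set [X] separates [a] from [c] in the minor on [F1] over [S']. Taking [S] deletes
   [e], taking [e |: S] contracts it. *)
pose bad S' X := [&& X \subset F1, a \in X, c \notin X &
  r (X :|: S') + r ((F1 :\: X) :|: S') <= r (F1 :|: S') + r S'].
have eF1 : e |: F1 = F by rewrite setD1K.
have [/existsP[X1 /and4P[X1F aX1 cX1 le1]]|ok1] := boolP [exists X, bad S X]; last first.
  have [|S' [SS' S'F par]] := IHn F1 S ltF1 aF1 cF1' nac.
    move=> X XF aX cX; rewrite ltnNge; apply: contra ok1 => le.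
    by apply/existsP; exists X; rewrite /bad XF aX cX.
  exists S'; split=> //; apply: subset_trans S'F _.
  by rewrite setSU // subsetDl.
have [/existsP[X2 /and4P[X2F aX2 cX2 le2]]|ok2] :=
  boolP [exists X, bad (e |: S) X]; last first.
  have [|S' [SS' S'F par]] := IHn F1 (e |: S) ltF1 aF1 cF1' nac.
    move=> X XF aX cX; rewrite ltnNge; apply: contra ok2 => le.
    by apply/existsP; exists X; rewrite /bad XF aX cX.
  exists S'; split=> //; first exact: subset_trans (subsetUr _ _) SS'.
  by apply: subset_trans S'F _; rewrite setUCA setUA eF1.
have FX X : X \subset F1 -> X \subset F.
  by move/subset_trans; apply; apply: subsetDl.
have PF1 : X1 :&: X2 \subset F1 by apply: subset_trans (subsetIl _ _) X1F.
have UF : e |: (X1 :|: X2) \subset F.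
  by rewrite subUset sub1set eF subUset !FX.
have eX1 : e \notin X1 by apply/negP => /(subsetP X1F); rewrite !inE eqxx.
have eX2 : e \notin X2 by apply/negP => /(subsetP X2F); rewrite !inE eqxx.
have := conn (X1 :&: X2) (FX _ PF1).
have := conn (e |: (X1 :|: X2)) UF.
rewrite !inE aX1 aX2 !orbT (negbTE cX1) (negbTE cX2) (eq_sym c) (negbTE nec).
move=> /(_ isT isT) lt2 /(_ isT isT) lt1.
(* Uncrossing [X1] with [X2]: connectivity at the meet and at the join with [e] gains two in total,
   while the rank of [e] accounts for at most one. *)
have s1 := rank_submod M (X1 :|: S) (X2 :|: (e |: S)).
have s2 := rank_submod M ((F1 :\: X1) :|: S) ((F1 :\: X2) :|: (e |: S)).
have i1 : r (X1 :&: X2 :|: S) <= r ((X1 :|: S) :&: (X2 :|: (e |: S))).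
  by apply: rankS; set_sub.
have u1 : r (e |: (X1 :|: X2) :|: S) <= r (X1 :|: S :|: (X2 :|: (e |: S))).
  by apply: rankS; set_sub.
have i2 : r (F :\: (e |: (X1 :|: X2)) :|: S) <=
    r ((F1 :\: X1 :|: S) :&: (F1 :\: X2 :|: (e |: S))).
  by apply: rankS; rewrite -eF1; set_sub.
have u2 : r (F :\: (X1 :&: X2) :|: S) <=
    r (F1 :\: X1 :|: S :|: (F1 :\: X2 :|: (e |: S))).
  by apply: rankS; rewrite -eF1; set_sub.
have eFS : F1 :|: (e |: S) = F :|: S by rewrite setUCA setUA eF1.
have le3 : r (F1 :|: S) <= r (F :|: S) by rewrite rankS // setSU // subsetDl.
have := rankU1_le e S; move: le1 le2 lt1 lt2 s1 s2 i1 i2 u1 u2 le3; rewrite eFS.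
by clear; lia.
Qed.
End RankExtra.

(** * Noncrossing orders *)

Section Noncrossing.
Variables (T : finType) (M : matroid T).
Implicit Types (B I J X Y Z S F : {set T}) (a b c d e x y : T) (p : T -> nat).
Local Notation r := (rank M).
Local Notation E := (ground M).

Definition isbase B : bool := (B \in indep M) && (#|B| == r E).

Definition between p a b c : bool := (p a < p b < p c) || (p c < p b < p a).

Lemma between_refl p a b : between p a b a = false.
Proof. by rewrite /between orbb; case: ltngtP. Qed.

(** Equal values of [between] put [b] and [d] on the same arc of the circle cut at [a] and [c], so
    the condition is one about the cyclic order. *)
Definition noncrossing p : Prop := forall S a b c d,
  #|S|.+2 = r E ->
  isbase (a |: (b |: S)) -> isbase (a |: (d |: S)) -> isbase (c |: (b |: S)) ->
  a |: (c |: S) \notin indep M -> between p a b c = between p a d c.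

Lemma rank_spanning_indep I X : I \in indep M -> I \subset X -> #|I| = r X ->
  forall Y, r (Y :|: I) = r (Y :|: X).
Proof.
move=> IM IX eI Y; rewrite !(setUC Y).
by apply: rank_spanU => //; rewrite rank_indep.
Qed.

(** The last hypothesis puts [x] in the closure of [y |: Z], hence in that of [y |: (B :\ x)], which
    therefore spans and is no larger than [B]. *)
Lemma isbase_exchange B Z x y : isbase B -> y \in E -> x \in B -> Z \subset B :\ x ->
  r (x |: (y |: Z)) = r (y |: Z) -> isbase (y |: (B :\ x)).
Proof.
move=> /andP[BM /eqP eB] yE xB ZB e1.
have BE := indep_ground BM.
have e2 : r (x |: (y |: (B :\ x))) = r (y |: (B :\ x)).
  by apply: (rank_closureS _ e1); apply: setUS.
have le1 : r E <= r (y |: (B :\ x)).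
  rewrite -e2 -eB -(rank_indep BM); apply: rankS.
  by rewrite setUCA setD1K // subsetUr.
have le2 : #|y |: (B :\ x)| <= r E.
  by have := cardsD1 x B; rewrite xB cardsU1 -eB => ->; case: (_ \notin _).
rewrite /isbase indep_rank ?(leq_trans le2) //= eqn_leq le2 /=.
exact: leq_trans le1 (rank_le_card _ _).
Qed.

(** The two parallel pairs may live over different sets, provided these are nested with [a] and [c]
    in the larger one: a base adapted to the chain carries both pairs into a single rank-two
    minor. *)
Lemma noncrossing_parallel p S1 S2 a b c d : noncrossing p ->
  parallel_over M S1 a c -> parallel_over M S2 b d -> S1 \subset S2 ->
  a \in S2 -> c \in S2 -> S2 \subset E -> b \in E -> d \in E ->
  between p a b c = between p a d c.
Proof.
move=> nc [ra rc rac] [rb rd rbd] S12 aS2 cS2 S2E bE dE.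
have [<-|nac] := eqVneq a c.
  by rewrite !between_refl.
have notin S x : r (x |: S) = (r S).+1 -> x \notin S.
  move=> e; apply/negP => xS; move: e.
  by rewrite (setUidPr _) ?sub1set // => /n_Sn.
have aS1 := notin _ _ ra; have bS2 := notin _ _ rb.
have nab : a != b by apply: contraNneq bS2 => <-.
have ncb : c != b by apply: contraNneq bS2 => <-.
(* [Z] is a basis of [S1], [J] will extend [a |: Z] to a basis of [S2], and [B] will extend [b |: J]
   to a base of [M]. *)
have [Z [ZM ZS1 eZ]] := rank_witness M S1.
have spZ := rank_spanning_indep ZM ZS1 (esym eZ).
have aZ : a \notin Z by apply: contra aS1; apply: (subsetP ZS1).
have aZM : a |: Z \in indep M.
  by apply: indep_rank; rewrite cardsU1 aZ spZ ra eZ.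
have aZS2 : a |: Z \subset S2.
  by rewrite subUset sub1set aS2 (subset_trans ZS1).
have [J [JM aZJ JS2 eJ]] := indep_extend aZM aZS2.
have spJ := rank_spanning_indep JM JS2 eJ.
have bJ : b \notin J by apply: contra bS2; apply: (subsetP JS2).
have bJM : b |: J \in indep M.
  by apply: indep_rank; rewrite cardsU1 bJ spJ rb eJ.
have bJE : b |: J \subset E by apply: indep_ground bJM.
have [B [BM bJB BE eB]] := indep_extend bJM bJE.
have aJ : a \in J by apply: (subsetP aZJ); rewrite !inE eqxx.
have aB : a \in B by apply: (subsetP bJB); rewrite !inE aJ orbT.
have bB : b \in B by apply: (subsetP bJB); rewrite !inE eqxx.
have baB : b \in B :\ a by rewrite !inE eq_sym nab.
pose S := B :\ a :\ b.
have bS : b |: S = B :\ a by rewrite setD1K.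
have eBS : a |: (b |: S) = B by rewrite bS setD1K.
have aS : a |: S = B :\ b.
  apply/setP => z; rewrite !inE; case: (z =P a) => // -> /=.
  by rewrite nab aB.
have ZB : Z \subset B :\ a.
  rewrite subsetD1 aZ andbT; apply: subset_trans bJB.
  by apply: subset_trans (subsetUr _ _); apply: subset_trans aZJ; apply: subsetUr.
have ZS : Z \subset S.
  rewrite subsetD1 ZB; apply: contra bS2 => bZ; apply: (subsetP S12).
  exact: (subsetP ZS1).
have cE := subsetP S2E c cS2.
have base : isbase B by rewrite /isbase BM eB eqxx.
have JB : J \subset B :\ b.
  by rewrite subsetD1 bJ andbT; apply: subset_trans bJB; apply: subsetUr.
apply: (nc S).
- have := cardsD1 b (B :\ a); have := cardsD1 a B.
  by rewrite aB baB -/S -eB => -> ->.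
- by rewrite eBS.
- rewrite setUCA aS; apply: (isbase_exchange base dE bB JB).
  by rewrite setUA !spJ -setUA rbd rd.
- rewrite bS; apply: (isbase_exchange base cE aB ZB).
  by rewrite setUA !spZ -setUA rac rc.
apply/negP => dep.
have : a |: (c |: Z) \in indep M by apply: indep_sub dep _; rewrite !setUS.
move/rank_indep; rewrite setUA spZ -setUA rac -setUA.
have cZ : c \notin Z.
  by apply: contra (notin _ _ rc); apply: (subsetP ZS1).
rewrite cardsU1 !inE negb_or nac aZ cardsU1 cZ eZ /=.
by clear; lia.
Qed.
End Noncrossing.

(** * Gaps of a circuit and cyclic intervals *)

Section Intervals.
Variables (T : finType) (M : matroid T) (p : T -> nat).
Implicit Types (B C I J X Y Z S F : {set T}) (a b c d e x y : T).
Local Notation r := (rank M).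
Local Notation E := (ground M).
Local Notation n := #|ground M|.

(** Positions are read modulo [n], so a window running past [n] wraps around the circle. *)
Definition cint (i j : nat) : {set T} :=
  [set x in E | has (fun k => p x == k %% n) (index_iota i j)].

Hypothesis nc : noncrossing M p.
Hypothesis p_inj : {in E &, injective p}.
Hypothesis p_lt : {in E, forall x, p x < n}.

Section Circuit.
Variable C : {set T}.
Hypothesis CE : C \subset E.
Hypothesis C_dep : C \notin indep M.
Hypothesis C_min : {in C, forall x, C :\ x \in indep M}.

Let C_gt0 : 0 < #|C|.
Proof. by rewrite card_gt0; apply: contraNneq C_dep => ->; apply: indep0. Qed.

Lemma rank_circuit : (r C).+1 = #|C|.
Proof.
have /card_gt0P[x xC] := C_gt0.
have := cardsD1 x C; rewrite xC add1n => ->; congr _.+1; apply/eqP.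
have := rankS M (subsetDl C [set x]); rewrite (rank_indep (C_min xC)).
rewrite eqn_leq => ->; rewrite andbT leqNgt; apply: contra C_dep => lt.
by apply: indep_rank; rewrite (cardsD1 x) xC.
Qed.

(** Contracting all but two elements of a circuit leaves a two-element circuit. These are the pairs
    to which the noncrossing condition is applied. *)
Lemma circuit_parallel a c : a \in C -> c \in C -> a != c ->
  parallel_over M (C :\ a :\ c) a c.
Proof.
move=> aC cC nac; have := rank_circuit.
have cCa : c \in C :\ a by rewrite !inE eq_sym nac.
have e1 : c |: (C :\ a :\ c) = C :\ a by rewrite setD1K.
have e2 : a |: (C :\ a :\ c) = C :\ c.
  by apply/setP => z; rewrite !inE; case: (z =P a) => // -> /=; rewrite nac aC.
have i0 : C :\ a :\ c \in indep M.
  exact: indep_sub (C_min aC) (subsetDl _ _).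
rewrite /parallel_over e1 e2 setD1K //.
rewrite (rank_indep i0) !(rank_indep (C_min _)) //.
have := cardsD1 a C; have := cardsD1 c C; have := cardsD1 c (C :\ a).
by rewrite aC cC cCa => ? ? ? ?; split; lia.
Qed.

Definition below x : nat := #|[set c in C | p c < p x]|.
(* The gaps before the first and after the last element of [C] are one gap of  *)
(* the cyclic order, whence the reduction modulo [#|C|].                       *)
Definition gap_index x : nat := below x %% #|C|.
Definition gap j : {set T} := [set x in E :\: C | gap_index x == j].

Let p_neq b c : b \in E -> b \notin C -> c \in C -> p b != p c.
Proof.
move=> bE bC cC; apply: contra bC => /eqP /(p_inj bE (subsetP CE _ cC)) ->.
by [].
Qed.

Let below_le x : below x <= #|C|.
Proof. by apply: subset_leq_card; apply/subsetP => y; rewrite inE => /andP[]. Qed.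

(** Elements that no pair of [C] separates have either none of [C] between them or all of it; in the
    second case they lie before the first and after the last element of [C], and the reduction
    modulo [#|C|] identifies these two ends. *)
Lemma gap_index_eq b d : b \in E -> b \notin C -> d \in E -> d \notin C ->
  {in C &, forall a c, between p a b c = between p a d c} ->
  gap_index b = gap_index d.
Proof.
wlog lebd : b d / p b <= p d.
  move=> H bE bC dE dC e; case: (leqP (p b) (p d)) => [|/ltnW] le; first exact: H.
  by apply/esym/H => // a c aC cC; rewrite e.
move=> bE bC dE dC btw.
have [/existsP[a /and3P[aC ba ad]]|no] :=
  boolP [exists a, [&& a \in C, p b < p a & p a < p d]]; last first.
  congr (_ %% _); apply: eq_card => c; rewrite !inE; case cC: (c \in C) => //=.
  apply/idP/idP => [lt|lt]; first exact: leq_trans lt lebd.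
  have := p_neq bE bC cC; rewrite neq_ltn => /orP[bc|//].
  by case/negP: no; apply/existsP; exists c; rewrite cC bc lt.
have -> : gap_index b = 0.
  suff e : [set c in C | p c < p b] = set0 by rewrite /gap_index /below e cards0 mod0n.
  apply/setP => c; rewrite !inE; apply/negP => /andP[cC cb].
  by have := btw c a cC aC; rewrite /between; move: ba ad cb; clear; lia.
suff e : [set c in C | p c < p d] = C by rewrite /gap_index /below e modnn.
apply/setP => c; rewrite !inE; case cC: (c \in C) => //=.
have := p_neq dE dC cC; rewrite neq_ltn => /orP[dc|//].
by have := btw a c aC cC; rewrite /between; move: ba ad dc; clear; lia.
Qed.

(** Otherwise an element of the gap is parallel to one outside it over a set containing [C]. Any two
    elements of [C] are parallel over the rest of [C], so the noncrossing condition forces both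
    elements into the same gap. *)
Lemma gap_skew j : r (gap j :|: C) + r (E :\: gap j) <= r E + r C.
Proof.
rewrite leqNgt; apply/negP => lt.
have gapE : gap j \subset E :\: C by apply/subsetP => x; rewrite inE => /andP[].
have eY : (E :\: C :\: gap j) :|: C = E :\: gap j.
  apply/setP => z; rewrite !inE; case zC: (z \in C) => /=; last by rewrite orbF.
  by rewrite (subsetP CE z zC).
have eE : gap j :|: (E :\: C :\: gap j) :|: C = E.
  rewrite -setUA eY; apply/setP => z; rewrite !inE.
  by case: (z \in E); case: (z \in C) => //=; case: (gap_index z == j).
have [|b [d [bK dY [S [CS SE par]]]]] :=
  @parallel_of_not_skew _ M (gap j) (E :\: C :\: gap j) C.
  by rewrite eE eY.
move: bK dY; rewrite !inE => /andP[/andP[bC bE] /eqP gb].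
move=> /andP[ng /andP[dC dE]]; move: ng; rewrite dC dE /= => /eqP; apply.
rewrite -gb; apply: gap_index_eq => // a c aC cC; apply/esym.
have [<-|nac] := eqVneq a c; first by rewrite !between_refl.
apply: (noncrossing_parallel nc (circuit_parallel aC cC nac) par); rewrite ?(subsetP CS) //.
  by apply: subset_trans CS; apply: subset_trans (subsetDl _ _) (subsetDl _ _).
by rewrite -eE.
Qed.

Lemma mem_cint_le i j x : x \in E -> i <= j < n ->
  (x \in cint i j.+1) = (i <= p x <= j).
Proof.
move=> xE /andP[ij jn]; rewrite inE xE /=; apply/hasP/idP => [[k]|h].
  by rewrite mem_index_iota => h /eqP->; rewrite modn_small; move: h jn; clear; lia.
exists (p x); last by rewrite modn_small ?p_lt.
by rewrite mem_index_iota ltnS.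
Qed.

Lemma mem_cint_wrap i j x : x \in E -> i < n -> j < n ->
  (x \in cint i (j + n).+1) = (i <= p x) || (p x <= j).
Proof.
move=> xE ltin ltjn; rewrite inE xE /=; apply/hasP/idP => [[k]|].
  rewrite mem_index_iota => h /eqP->; have [ltk|lek] := ltnP k n.
    by rewrite modn_small //; move: h; clear; lia.
  rewrite -(subnK lek) modnDr modn_small; move: h lek ltjn; clear; lia.
have lt := p_lt xE; case/orP => h.
  by exists (p x); rewrite ?modn_small // mem_index_iota; move: h lt; clear; lia.
exists (p x + n); rewrite ?modnDr ?modn_small // mem_index_iota.
by move: h ltin lt; clear; lia.
Qed.

Lemma below_strict c x y : c \in C -> p x <= p c < p y -> below x < below y.
Proof.
move=> cC /andP[xc cy]; apply: proper_card; apply/properP; split.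
  apply/subsetP => z; rewrite !inE => /andP[-> /leq_trans]; apply.
  exact: leq_trans xc (ltnW cy).
by exists c; rewrite inE cC ?cy //= -leqNgt.
Qed.

Lemma below_eq0 x : {in C, forall c, p x <= p c} -> below x = 0.
Proof.
move=> h; apply/eqP; rewrite cards_eq0; apply/eqP/setP => c; rewrite !inE.
by apply/negP => /andP[/h]; rewrite leqNgt => /negP.
Qed.

Lemma below_full x : {in C, forall c, p c < p x} -> below x = #|C|.
Proof.
move=> h; apply: eq_card => c; rewrite inE.
by case cC: (c \in C) => //=; rewrite h.
Qed.

(** A nonempty gap lies either between two consecutive elements of [C], and its complement wraps
    around, or outside the range of [C], and its complement runs from the first to the last
    element. *)
Lemma gapC_interval j : exists i k, i <= k <= i + n /\ E :\: gap j = cint i k.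
Proof.
have pC c : c \in C -> p c < n by move/(subsetP CE)/p_lt.
have [x|K0] := pickP (mem (gap j)); last first.
  exists 0, n; split=> //; first by rewrite add0n leqnn.
  apply/setP => z; case zE: (z \in E); last by rewrite !inE zE andbF.
  have n0 : 0 < n by apply/card_gt0P; exists z.
  have -> : cint 0 n = cint 0 n.-1.+1 by rewrite prednK.
  have ltn1 : 0 <= n.-1 < n by rewrite prednK //=.
  rewrite (mem_cint_le zE ltn1) in_setD zE andbT.
  by have /= -> := K0 z; rewrite -ltnS prednK // p_lt.
rewrite /= inE => /andP[/setDP[xE xC] /eqP gx].
have inK z : z \in E -> (z \in E :\: gap j) = (z \in C) || (gap_index z != j).
  by move=> zE; rewrite !inE zE !andbT /= negb_and negbK.
have [/andP[/existsP[a1 a1P] /existsP[a2 a2P]]|no] :=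
  boolP ([exists a, (a \in C) && (p a < p x)] && [exists a, (a \in C) && (p x < p a)]).
  case: (@arg_maxnP _ a1 (fun a => (a \in C) && (p a < p x)) p a1P) => c1 /andP[c1C c1x] max1.
  have {}max1 c : c \in C -> p c < p x -> p c <= p c1.
    by move=> cC h; apply: max1; rewrite cC.
  case: (@arg_minnP _ a2 (fun a => (a \in C) && (p x < p a)) p a2P) => c2 /andP[c2C xc2] min2.
  have {}min2 c : c \in C -> p x < p c -> p c2 <= p c.
    by move=> cC h; apply: min2; rewrite cC.
  have ux0 : 0 < below x.
    by apply/card_gt0P; exists c1; rewrite inE c1C.
  have uxk : below x < #|C|.
    by apply: proper_card; apply/properP; split;
      [apply/subsetP => z; rewrite inE => /andP[] | exists c2; rewrite // inE c2C -leqNgt ltnW].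
  move: gx; rewrite /gap_index modn_small // => gx.
  (* [c1] and [c2] are the neighbours of [x] in [C]; the complement goes from [c2] around to [c1],
     inclusive. *)
  exists (p c2), (p c1 + n).+1; split.
    by move: c1x xc2 (pC _ c2C); clear; lia.
  apply/setP => z; case zE: (z \in E); last by rewrite !inE zE andbF.
  rewrite mem_cint_wrap ?pC // inK //.
  case zC: (z \in C) => /=.
    have := p_neq xE xC zC; rewrite neq_ltn => /orP[xz|zx].
      by rewrite (min2 z zC xz).
    by rewrite (max1 z zC zx) orbT.
  have [le2|lt2] := leqP (p c2) (p z).
    have lt : below x < below z.
      apply: (below_strict c2C); rewrite (ltnW xc2) ltn_neqAle le2 andbT eq_sym.
      by rewrite (p_neq zE) ?zC.
    rewrite /gap_index -gx; have := below_le z; rewrite leq_eqVlt => /orP[/eqP->|ltk].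
      by rewrite modnn neq_ltn ux0.
    by rewrite modn_small // neq_ltn lt orbT.
  have [le1|lt1] := leqP (p z) (p c1).
    have lt : below z < below x.
      by apply: (below_strict c1C); rewrite le1.
    by rewrite /gap_index -gx modn_small ?neq_ltn ?lt // (ltn_trans lt).
  apply/negbTE; rewrite negbK /gap_index -gx -(modn_small uxk); apply/eqP.
  congr (_ %% _); apply: eq_card => c; rewrite !inE; case cC: (c \in C) => //=.
  apply/idP/idP => h.
    have := p_neq xE xC cC; rewrite neq_ltn => /orP[xc|//].
    by have := min2 c cC xc; move: h lt2; clear; lia.
  by have := max1 c cC h; move: lt1; clear; lia.
have gx0 : gap_index x = 0.
  move: no; rewrite negb_and !negb_exists => /orP[]/forallP no; rewrite /gap_index.
    rewrite below_eq0 ?mod0n // => c cC.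
    by have := no c; rewrite cC /= -leqNgt.
  rewrite below_full ?modnn // => c cC.
  have := no c; rewrite cC /= -leqNgt => le.
  by rewrite ltn_neqAle le eq_sym p_neq.
have j0 : j = 0 by rewrite -gx gx0.
have [c0 c0C] : exists c, c \in C by apply/card_gt0P.
case: (@arg_minnP _ c0 (fun a => a \in C) p c0C) => c1 c1C min1.
case: (@arg_maxnP _ c0 (fun a => a \in C) p c0C) => c2 c2C max2'.
have max2 c : c \in C -> p c <= p c2 := max2' c.
have le12 := min1 c2 c2C.
exists (p c1), (p c2).+1; split; first by move: le12 (pC _ c2C); clear; lia.
apply/setP => z; case zE: (z \in E); last by rewrite !inE zE andbF.
rewrite mem_cint_le ?le12 ?pC // inK // j0.
case zC: (z \in C) => /=; first by rewrite min1 // max2.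
have [le1|lt1] := leqP (p c1) (p z); last first.
  rewrite /gap_index below_eq0 ?mod0n // => c cC.
  exact: ltnW (leq_trans lt1 (min1 c cC)).
have [le2|lt2] := leqP (p z) (p c2); last first.
  rewrite /gap_index below_full ?modnn // => c cC.
  exact: leq_ltn_trans (max2 c cC) lt2.
have z1 : p c1 < p z by rewrite ltn_neqAle le1 eq_sym (p_neq zE) ?zC.
have ltk : below z < #|C|.
  apply: proper_card; apply/properP; split.
    by apply/subsetP => c; rewrite inE => /andP[].
  by exists c2; rewrite // inE c2C -leqNgt.
rewrite -lt0n /gap_index modn_small //.
by apply/card_gt0P; exists c1; rewrite inE c1C.
Qed.
End Circuit.

(** Interval bounds on the complements of the gaps become lower bounds on the number of elements of
    [B] inside the gaps, and skewness lets these add up; a circuit inside [B] then makes [B] too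
    large. *)
Lemma indep_of_cint B : B \subset E -> #|B| = r E ->
  (forall i k, i <= k <= i + n -> #|B :&: cint i k| <= r (cint i k)) ->
  B \in indep M.
Proof.
move=> BE eB hB; apply/negPn/negP => Bdep.
have [C /minsetP[/= C_dep minC] CB] :=
  @minset_exists _ [pred X : {set T} | X \notin indep M] B Bdep.
have C_min : {in C, forall x, C :\ x \in indep M}.
  move=> x xC; apply/negPn/negP => /minC/(_ (subsetDl _ _)) e.
  by move: xC; rewrite -e !inE eqxx.
have CE := subset_trans CB BE.
have C0 : 0 < #|C|.
  by rewrite card_gt0; apply: contraNneq C_dep => ->; apply: indep0.
have hgap j : #|B :\: gap C j| <= r (E :\: gap C j).
  have [i [k [ik e]]] := gapC_interval CE C_dep j.
  rewrite e; apply: leq_trans (hB i k ik); rewrite -e.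
  by rewrite setIDA (setIidPl BE).
(* The gaps are added one at a time, each by submodularity over [C]; at [m = #|C|] they exhaust
   [E :\: C]. *)
pose W m := [set x in E :\: C | gap_index C x < m].
suff le m : r (W m :|: C) <= r C + #|B :&: W m|.
  have := le #|C|.
  have -> : W #|C| = E :\: C.
    by apply/setP => x; rewrite !inE ltn_mod C0 andbT.
  have -> : E :\: C :|: C = E by rewrite setUC -[RHS](setID _ C) (setIidPr CE).
  rewrite setIDA (setIidPl BE) -eB.
  have := cardsID C B; rewrite (setIidPr CB).
  by have := rank_circuit C_dep C_min; clear; lia.
elim: m => [|m IHm].
  have -> : W 0 = set0 by apply/setP => x; rewrite !inE andbF.
  by rewrite set0U leq_addr.
have eW : W m.+1 = W m :|: gap C m.
  by apply/setP => x; rewrite !inE ltnS leq_eqVlt -andb_orr orbC.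
have disj : W m :&: gap C m = set0.
  apply/setP => x; rewrite !inE; case: eqP => [->|]; last by rewrite !andbF.
  by rewrite ltnn !andbF.
have := gap_skew CE C_dep C_min m; have := hgap m.
have := cardsID (gap C m) B.
have := rank_submod M (W m :|: C) (gap C m :|: C).
have := rankS M (_ : C \subset (W m :|: C) :&: (gap C m :|: C)).
rewrite subsetI !subsetUr => /(_ isT).
have -> : W m :|: C :|: (gap C m :|: C) = W m.+1 :|: C.
  by rewrite eW setUACA setUid.
have := cardsUI (B :&: W m) (B :&: gap C m).
have -> : B :&: W m :&: (B :&: gap C m) = set0 by rewrite setIACA disj setI0.
rewrite cards0 -setIUr -eW; move: IHm eB; clear; lia.
Qed.
End Intervals.

(** * Expansions *)

Section CyclicFlats.
Variables (T : finType) (M : matroid T).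
Implicit Types (X Y Z F : {set T}) (e x : T).
Local Notation r := (rank M).
Local Notation E := (ground M).

(** Strip [X] of its coloops, each of which counts one, then close up: the closure of a set without
    coloops is a cyclic flat. Minimality of [Y] does the first, maximality of [Z] the second. *)
Lemma rank_cyclic_flat X : X \subset E ->
  exists2 Z, cyclic_flat M Z & r X = r Z + #|X :\: Z|.
Proof.
move=> XE; pose ok Y := (Y \subset X) && (r Y + #|X :\: Y| == r X).
have okX : ok X by rewrite /ok subxx setDv cards0 addn0 eqxx.
have [Y /minsetP[/andP[YX /eqP eY] minY] _] := minset_exists okX.
have YE := subset_trans YX XE.
have nocoloop e : e \in Y -> r (Y :\ e) = r Y.
  move=> eYY; apply/eqP; rewrite eqn_leq rankS ?subsetDl //= leqNgt.
  apply/negP => lt; have : Y :\ e = Y; last first.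
    by move/setP/(_ e); rewrite !inE eYY eqxx.
  apply: minY; last exact: subsetDl.
  rewrite /ok (subset_trans (subsetDl _ _) YX) /= eqn_leq.
  have eX : X :\: (Y :\ e) = e |: (X :\: Y).
    apply/setP => z; rewrite !inE; case: (z =P e) => //= ->.
    by rewrite (subsetP YX e eYY).
  have := rankU_le M (Y :\ e) X.
  rewrite setUC (setUidPl _) ?(subset_trans (subsetDl _ _)) // => ->; rewrite andbT.
  by rewrite eX cardsU1 inE eYY /=; move: lt eY; clear; lia.
pose cl Z := (Y \subset Z) && (Z \subset E) && (r Z == r Y).
have clY : cl Y by rewrite /cl subxx YE eqxx.
have [Z /maxsetP[/andP[/andP[YZ ZE] /eqP eZ] maxZ] _] := maxset_exists clY.
exists Z; last first.
  apply/eqP; rewrite eqn_leq -{2}eY eZ leq_add2l subset_leq_card ?setDS // andbT.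
  by rewrite -eZ; apply: leq_trans (rankU_le M Z X); apply/rankS/subsetUr.
split.
  rewrite /flat ZE; apply/forallP => x; apply/implyP => /setDP[xE xZ].
  rewrite ltn_neqAle leq_rankU1 andbT; apply: contra xZ => /eqP e.
  have /maxZ/(_ (subsetUr _ _)) <- : cl (x |: Z); last by rewrite !inE eqxx.
  rewrite /cl -e eZ eqxx subUset sub1set xE ZE !andbT.
  exact: subset_trans YZ (subsetUr _ _).
move=> e; apply/negP; rewrite coloop_restrictE // => /andP[eZZ].
rewrite eZ ltnNge => /negP; apply.
have [eYY|eYN] := boolP (e \in Y).
  by rewrite -(nocoloop e eYY); apply/rankS/setSD.
by apply: rankS; rewrite subsetD1 YZ.
Qed.
End CyclicFlats.

Lemma cardU1I (T : finType) (x : T) (X F : {set T}) : x \notin X ->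
  #|(x |: X) :&: F| = (x \in F) + #|X :&: F|.
Proof.
move=> xX; rewrite (cardsD1 x) !inE eqxx; congr (_ + #|pred_of_set _|).
by apply/setP => z; rewrite !inE; case: (z =P x) => // ->; rewrite (negbTE xX).
Qed.

Section Expansion.
Variables (T : finType) (t : nat) (M N : matroid T) (S : T -> {set T}).
Hypothesis hS : expansion_blocks t (ground M) S.
Hypothesis hN : is_expansion t S M N.
Implicit Types (A B I X Y F : {set T}) (e f x y : T) (p : T -> nat).
Local Notation E := (ground M).

Lemma block_inj e f y : e \in E -> f \in E -> y \in S e -> y \in S f -> e = f.
Proof.
move=> eE fE ye yf; apply/eqP/negPn/negP => nef.
have [_ _ dS] := hS.
by have /pred0P/(_ y)/= := dS e f eE fE nef; rewrite ye yf.
Qed.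

Lemma card_blow_up_cap I A : A \subset E ->
  #|I :&: blow_up S A| = \sum_(e in A) #|I :&: S e|.
Proof.
have [n] := ubnP #|A|; elim: n A => // n IHn A ltA AE.
have [->|[e eA]] := set_0Vmem A; first by rewrite /blow_up !big_set0 setI0 cards0.
have cA := cardsD1 e A; rewrite eA in cA.
rewrite (big_setD1 e) //= -IHn; first last.
- exact: subset_trans (subsetDl _ _) AE.
- by move: ltA cA; clear; lia.
rewrite /blow_up (big_setD1 e) //= setIUr cardsU [X in _ - X](_ : _ = 0) ?subn0 //.
apply/eqP; rewrite cards_eq0; apply/eqP/setP => y; rewrite !inE.
apply/negP => /andP[/andP[_ ye] /andP[_ /bigcupP[f /setD1P[nfe fA] yf]]].
by case/eqP: nfe; apply: block_inj yf ye; apply: (subsetP AE).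
Qed.

Lemma card_block e : e \in E -> #|S e| = t.
Proof. by have [_ cS _] := hS => /cS. Qed.

Lemma mem_block e : e \in E -> e \in S e.
Proof. by have [mS _ _] := hS => /mS. Qed.

Lemma blow_up_block A e : e \in A -> S e \subset blow_up S A.
Proof. by move=> eA; apply: (bigcup_sup e). Qed.

Lemma mem_blow_upE A e y : A \subset E -> e \in E -> y \in S e ->
  (y \in blow_up S A) = (e \in A).
Proof.
move=> AE eE ye; apply/bigcupP/idP => [[f fA yf]|eA]; last by exists e.
by rewrite (block_inj eE (subsetP AE f fA) ye yf).
Qed.

(** An expansion is specified on cyclic flats only. [rank_cyclic_flat] in [M] spreads the bounds to
    every [A]; in [N] it expresses the rank of [I] through one cyclic flat, where a single bound
    suffices. *)
Lemma indep_expansionP I : reflect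
  (I \subset blow_up S E /\
    forall A, A \subset E -> #|I :&: blow_up S A| <= t * rank M A)
  (I \in indep N).
Proof.
have [gN cfN rN] := hN; apply: (iffP idP) => [IN|[IE hI]].
  split=> [|A AE]; first by rewrite -gN; apply: indep_ground.
  have [Z cZ ->] := rank_cyclic_flat AE.
  have ZE : Z \subset E by case: cZ => /andP[].
  have AZE : A :\: Z \subset E by apply: subset_trans (subsetDl _ _) AE.
  rewrite mulnDr -(rN _ cZ).
  apply: (@leq_trans (#|I :&: blow_up S Z| + #|I :&: blow_up S (A :\: Z)|)).
    apply: leq_trans (leq_card_setU _ _); apply: subset_leq_card.
    rewrite -setIUr setIS // /blow_up -bigcup_setU.
    apply/bigcupsP => e eA; apply: (bigcup_sup e) => //.
    by rewrite !inE eA andbT orbN.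
  apply: leq_add.
    by apply: card_le_rank (subsetIr _ _); apply: indep_sub IN (subsetIl _ _).
  rewrite card_blow_up_cap // mulnC -sum_nat_const; apply: leq_sum => e eA.
  rewrite -(card_block (subsetP AZE _ eA)).
  exact/subset_leq_card/subsetIr.
apply: indep_rank.
have [|F cF ->] := @rank_cyclic_flat _ N I; first by rewrite gN.
have [A cA eF] := (cfN F).1 cF.
have AE : A \subset E by case: cA => /andP[].
by rewrite eF rN // -(cardsID (blow_up S A) I) leq_add2r hI.
Qed.

Lemma blow_up_sub A : A \subset E -> blow_up S A \subset blow_up S E.
Proof.
by move=> AE; apply/bigcupsP => e eA; apply/blow_up_block/(subsetP AE).
Qed.

Lemma card_blow_up_capI A B : A \subset E -> B \subset E ->
  #|blow_up S B :&: blow_up S A| = t * #|B :&: A|.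
Proof.
move=> AE BE; rewrite card_blow_up_cap //.
rewrite (eq_bigr (fun e => t * (e \in B))) => [|e eA].
  rewrite -big_distrr -big_mkcondr /= sum1_card; congr (t * _).
  by apply: eq_card => e; rewrite !inE andbC.
have eE := subsetP AE e eA; have [eB|eB] := boolP (e \in B).
  by rewrite (setIidPr (blow_up_block eB)) card_block // muln1.
apply/eqP; rewrite muln0 cards_eq0; apply/eqP/setP => y; rewrite !inE.
by apply/negP => /andP[yB ye]; move: eB; rewrite -(mem_blow_upE BE eE ye) yB.
Qed.

Lemma card_blow_up B : B \subset E -> #|blow_up S B| = t * #|B|.
Proof. by move=> BE; have := card_blow_up_capI BE BE; rewrite !setIid. Qed.

Lemma card_cap_le_rank B A : B \in indep M -> #|B :&: A| <= rank M A.
Proof.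
by move=> BM; apply: card_le_rank (subsetIr _ _); apply: indep_sub BM (subsetIl _ _).
Qed.

Lemma indep_blow_up B : B \in indep M -> blow_up S B \in indep N.
Proof.
move=> BM; have BE := indep_ground BM.
apply/indep_expansionP; split=> [|A AE]; first exact: blow_up_sub.
by rewrite card_blow_up_capI // leq_mul2l card_cap_le_rank ?orbT.
Qed.

Lemma rank_expansion : rank N (ground N) = t * rank M E.
Proof.
have [gN _ _] := hN.
have [B [BM BE eB]] := rank_witness M E.
apply/eqP; rewrite eqn_leq; apply/andP; split.
  have [I [IN IE ->]] := rank_witness N (ground N).
  have /indep_expansionP[IS hI] := IN.
  by have := hI E (subxx _); rewrite (setIidPl IS).
rewrite eB -card_blow_up //; apply: card_le_rank; first exact: indep_blow_up.
by rewrite gN blow_up_sub.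
Qed.

(** Only an [A] with [d] inside and [b] outside can gain an element. There the base [d |: (B :\ b)]
    shows that [B] does not fill the rank of [A], which leaves room for [t >= 1] more. *)
Lemma blow_up_exchange B b d : b \in B -> d \in E -> d \notin B ->
  isbase M B -> isbase M (d |: (B :\ b)) -> isbase N (d |: (blow_up S B :\ b)).
Proof.
move=> bB dE dB /andP[BM /eqP eB] /andP[BM' _].
have BE := indep_ground BM; have bE := subsetP BE b bB.
have bb := mem_block bE; have dd := mem_block dE.
have t0 : 0 < t by rewrite -(card_block bE); apply/card_gt0P; exists b.
have bSB : b \in blow_up S B by rewrite (mem_blow_upE BE bE bb).
have dSB : d \notin blow_up S B by rewrite (mem_blow_upE BE dE dd).
rewrite /isbase rank_expansion -eB -card_blow_up // [X in _ && X](_ : _ = true); last first.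
  have := cardsD1 b (blow_up S B); rewrite bSB => ->.
  by rewrite cardsU1 in_setD1 (negbTE dSB) andbF /= eqxx.
rewrite andbT; apply/indep_expansionP; split=> [|A AE].
  rewrite subUset sub1set (mem_blow_upE _ dE dd) ?dE //.
  by rewrite (subset_trans (subsetDl _ _)) ?blow_up_sub.
have eBA := card_blow_up_capI AE BE.
have leA : t * #|B :&: A| <= t * rank M A by rewrite leq_mul2l card_cap_le_rank ?orbT.
have bA := mem_blow_upE AE bE bb; have dA := mem_blow_upE AE dE dd.
have [dA'|dA'] := boolP (d \in A); last first.
  apply: leq_trans leA; rewrite -eBA; apply: subset_leq_card.
  apply/subsetP => z; rewrite !inE; case: (z =P d) => [->|_] /=.
    by rewrite dA (negbTE dA').
  by case/andP => /andP[_ ->].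
have [bA'|bA'] := boolP (b \in A).
  apply: leq_trans leA; rewrite -eBA.
  rewrite (cardsD1 b (blow_up S B :&: _)) in_setI bSB bA bA' /=.
  apply: (@leq_trans #|d |: ((blow_up S B :&: blow_up S A) :\ b)|).
    apply: subset_leq_card; apply/subsetP => z; rewrite !inE.
    by case: (z =P d) => //= _; case: (z =P b) => //= _; case/andP => -> ->.
  by rewrite cardsU1; case: (_ \notin _); rewrite ?leqnSn.
apply: (@leq_trans #|d |: (blow_up S B :&: blow_up S A)|).
  apply: subset_leq_card; apply/subsetP => z; rewrite !inE.
  by case: (z =P d) => //= _; case/andP => /andP[_ ->] ->.
have lt : #|B :&: A| < rank M A.
  apply: leq_trans (card_cap_le_rank A BM').
  have -> : (d |: (B :\ b)) :&: A = d |: (B :&: A).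
    apply/setP => z; rewrite !inE; case: (z =P d) => [->|_] /=; first by rewrite dA'.
    by case: (z =P b) => //= ->; rewrite (negbTE bA') andbF.
  by rewrite cardsU1 !inE (negbTE dB).
rewrite cardsU1 eBA; apply: (@leq_trans (t * (#|B :&: A|).+1)).
  by rewrite mulnS leq_add2r; case: (_ \notin _).
by rewrite leq_mul2l lt orbT.
Qed.

(** The common set of the configuration in [N] is the blow-up of the base [B] less [a] and [b].
    Single elements are exchanged, which keeps the three bases, while the dependence persists by
    counting. *)
Lemma noncrossing_of_expansion p : noncrossing N p -> noncrossing M p.
Proof.
move=> nc X a b c d eX bab bad bcb dep.
have [<-|nac] := eqVneq a c; first by rewrite !between_refl.
have [<-//|nbd] := eqVneq b d.
pose B := a |: (b |: X).
have [/andP[BM /eqP eB] /andP[adM /eqP ead] /andP[cbM /eqP ecb]] := And3 bab bad bcb.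
have BE := indep_ground BM.
have mem_ground x Y : x |: Y \in indep M -> x \in E.
  by move/indep_ground/subsetP; apply; rewrite !inE eqxx.
have aE : a \in E := mem_ground _ _ BM.
have cE : c \in E := mem_ground _ _ cbM.
have bE : b \in E by apply: (mem_ground _ (a |: X)); rewrite setUCA.
have dE : d \in E by apply: (mem_ground _ (a |: X)); rewrite setUCA.
have fresh x y : #|x |: (y |: X)| = rank M E -> [/\ x != y, x \notin X & y \notin X].
  rewrite -eX !cardsU1 !inE; case: eqP => [->|_]; case: (y \in X); case: (x \in X) => //=; clear; lia.
have [nab aX bX] := fresh _ _ eB.
have [nad _ dX] := fresh _ _ ead.
have [ncb cX _] := fresh _ _ ecb.
have aB : a \in B by rewrite !inE eqxx.
have bB : b \in B by rewrite !inE eqxx orbT.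
have dB : d \notin B by rewrite !inE !negb_or eq_sym nad eq_sym nbd dX.
have cB : c \notin B by rewrite !inE !negb_or eq_sym nac ncb cX.
have [aa bb] := (mem_block aE, mem_block bE).
have [cc dd] := (mem_block cE, mem_block dE).
pose S' := blow_up S B :\ a :\ b.
have aSB : a \in blow_up S B by rewrite (mem_blow_upE BE aE aa).
have bSB : b \in blow_up S B by rewrite (mem_blow_upE BE bE bb).
have baSB : b \in blow_up S B :\ a by rewrite !inE eq_sym nab.
have bS' : b |: S' = blow_up S B :\ a by rewrite setD1K.
have eS' : a |: (b |: S') = blow_up S B by rewrite bS' setD1K.
have aS' : a |: S' = blow_up S B :\ b.
  by apply/setP => z; rewrite !inE; case: (z =P a) => // -> /=; rewrite nab aSB.
have baseB : isbase N (blow_up S B).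
  by rewrite /isbase indep_blow_up // rank_expansion card_blow_up // eB eqxx.
apply: (nc S').
- rewrite rank_expansion -eB -card_blow_up //.
  by rewrite (cardsD1 a (blow_up S B)) aSB (cardsD1 b (_ :\ a)) baSB.
- by rewrite eS'.
- rewrite setUCA aS'; apply: blow_up_exchange => //.
  rewrite [B :\ b](_ : _ = a |: X) 1?setUCA //.
  by rewrite /B setUCA setU1K // !inE negb_or eq_sym nab.
- rewrite bS'; apply: blow_up_exchange => //.
  by rewrite [B :\ a](_ : _ = b |: X) // /B setU1K // !inE negb_or nab.
apply/negP => /indep_expansionP[_ le].
pose A := a |: (c |: X).
have AE : A \subset E.
  rewrite !subUset !sub1set aE cE /=; apply: subset_trans BE.
  by rewrite /B setUCA; apply: subset_trans (subsetUr _ _); apply: subsetUr.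
have cA : #|A| = rank M E.
  by rewrite -eX !cardsU1 !inE negb_or nac aX cX.
have ltA : rank M A < rank M E.
  by rewrite -cA ltnNge; apply: contra dep => /indep_rank.
have aXE : a |: X \subset E by apply: subset_trans AE; apply/setUS/subsetUr.
have := le A AE; apply/negP; rewrite -ltnNge.
(* As [A] is dependent its rank is at most [#|a |: X|], whereas the set in [N] contains the whole
   blow-up of [a |: X] and also [c]. *)
apply: (@leq_trans #|c |: blow_up S (a |: X)|); last first.
  apply: subset_leq_card; apply/subsetP => z; rewrite inE => /orP[|zaX].
    by move/set1P->; rewrite in_setI (mem_blow_upE AE cE cc) !in_setU1 eqxx !orbT.
  rewrite inE setUCA aS' in_setU in_setD1; apply/andP; split.
    apply/orP; right; apply/andP; split.
      apply: contraTneq zaX => ->.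
      by rewrite (mem_blow_upE aXE bE bb) !inE negb_or eq_sym nab.
    by case/bigcupP: zaX => e /setU1P[->|eX'] ze; apply/bigcupP; [exists a | exists e => //; rewrite !inE eX' !orbT].
  case/bigcupP: zaX => e eaX ze; apply/bigcupP; exists e => //.
  by move: eaX; rewrite !inE => /orP[->|->]; rewrite ?orbT.
rewrite cardsU1 (mem_blow_upE aXE cE cc) !inE negb_or eq_sym nac cX add1n ltnS.
rewrite card_blow_up // leq_mul2l; apply/orP; right.
by rewrite cardsU1 aX -ltnS add1n eX.
Qed.
Definition block y : T := odflt y [pick e in E | y \in S e].

Lemma blockP y : y \in blow_up S E -> block y \in E /\ y \in S (block y).
Proof.
move=> /bigcupP[e eE ye]; rewrite /block; case: pickP => [f /andP[]//|/(_ e)].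
by rewrite eE ye.
Qed.

(** Blocks are consecutive in the order [p], and the enumeration of [T] breaks ties inside a block;
    the factor exceeds every [enum_rank]. *)
Definition block_lexi p y : nat := p (block y) * #|T|.+1 + enum_rank y.

Lemma block_lexi_lt p x y : p (block x) < p (block y) ->
  block_lexi p x < block_lexi p y.
Proof.
move=> lt; apply: (@leq_trans (p (block y) * #|T|.+1)); last exact: leq_addr.
apply: leq_trans (leq_mul lt (leqnn _)).
by rewrite /block_lexi mulSn addnC ltn_add2r ltnS ltnW.
Qed.

Lemma block_lexi_inj p : {in E &, injective p} ->
  {in blow_up S E &, injective (block_lexi p)}.
Proof.
move=> pI x y xS yS e.
have [bx _] := blockP xS; have [by' _] := blockP yS.
have epb : p (block x) = p (block y).
  by case: (ltngtP (p (block x)) (p (block y))) => // /block_lexi_lt; rewrite e ltnn.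
by move: e; rewrite /block_lexi epb => /addnI/ord_inj/enum_rank_inj.
Qed.

Lemma between_block_lexi p a b c :
  p (block a) != p (block b) -> p (block b) != p (block c) ->
  between (block_lexi p) a b c = between p (block a) (block b) (block c).
Proof.
have lexiE x y : p (block x) != p (block y) ->
    (block_lexi p x < block_lexi p y) = (p (block x) < p (block y)).
  rewrite neq_ltn => /orP[lt|lt]; first by rewrite lt block_lexi_lt.
  by rewrite ltnNge ltnW ?block_lexi_lt // ltnNge ltnW.
by move=> nab nbc; rewrite /between !lexiE // eq_sym.
Qed.

(** A set [A] whose bound fails for the dependent set yields two connectivity statements, in [M|A]
    and in [M/A]. They give parallel pairs over nested sets, to which [noncrossing_parallel]
    applies. *)
Lemma noncrossing_expansion p : {in E &, injective p} ->
  noncrossing M p -> noncrossing N (block_lexi p).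
Proof.
move=> pI nc X a b c d eX /andP[abN /eqP cab] /andP[adN /eqP cad] /andP[cbN /eqP ccb] dep.
have [<-|nac] := eqVneq a c; first by rewrite !between_refl.
have [<-//|nbd] := eqVneq b d.
have fresh x y : #|x |: (y |: X)| = rank N (ground N) -> [/\ x != y, x \notin X & y \notin X].
  rewrite -eX !cardsU1 !inE.
  by case: eqP => [->|_]; case: (y \in X); case: (x \in X) => //=; clear; lia.
have [nab aX bX] := fresh _ _ cab.
have [nad _ dX] := fresh _ _ cad.
have [ncb cX _] := fresh _ _ ccb.
have [gN _ _] := hN.
have memS x Y : x |: Y \in indep N -> x \in blow_up S E.
  by move/indep_ground; rewrite gN => /subsetP; apply; rewrite !inE eqxx.
have [aE aa] := blockP (memS _ _ abN).
have [cE cc] := blockP (memS _ _ cbN).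
have [bE bb] : block b \in E /\ b \in S (block b).
  by apply/blockP/(memS _ (a |: X)); rewrite setUCA.
have [dE dd] : block d \in E /\ d \in S (block d).
  by apply/blockP/(memS _ (a |: X)); rewrite setUCA.
have XE : X \subset blow_up S E.
  move/indep_ground: abN; rewrite gN; apply: subset_trans.
  exact: subset_trans (subsetUr _ _) (subsetUr _ _).
pose m A := #|X :&: blow_up S A|.
have card2 A x y : A \subset E -> block x \in E -> x \in S (block x) ->
    block y \in E -> y \in S (block y) -> x != y -> x \notin X -> y \notin X ->
    #|(x |: (y |: X)) :&: blow_up S A| = (block x \in A) + (block y \in A) + m A.
  move=> AE xE xx yE yy nxy xX yX.
  rewrite -(mem_blow_upE AE xE xx) -(mem_blow_upE AE yE yy).
  by rewrite !cardU1I ?addnA // !inE negb_or nxy.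
have bound x y A : x |: (y |: X) \in indep N -> A \subset E ->
    block x \in E -> x \in S (block x) -> block y \in E -> y \in S (block y) ->
    x != y -> x \notin X -> y \notin X ->
    (block x \in A) + (block y \in A) + m A <= t * rank M A.
  move=> /indep_expansionP[_ le] AE ? ? ? ? ? ? ?; rewrite -card2 //; exact: le.
have [A AE ltA] : exists2 A : {set T}, A \subset E &
    t * rank M A < (block a \in A) + (block c \in A) + m A.
  have [/existsP[A /andP[AE lt]]|/existsPn no] := boolP [exists A : {set T}, (A \subset E) &&
      (t * rank M A < (block a \in A) + (block c \in A) + m A)].
    by exists A.
  case/negP: dep; apply/indep_expansionP; split=> [|A AE].
    by rewrite !subUset !sub1set (memS _ _ abN) (memS _ _ cbN) XE.
  by rewrite card2 // leqNgt; have := no A; rewrite AE.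
have bab Y YE := bound a b Y abN YE aE aa bE bb nab aX bX.
have bad Y YE := bound a d Y adN YE aE aa dE dd nad aX dX.
have bcb Y YE := bound c b Y cbN YE cE cc bE bb ncb cX bX.
have [aA cA bA dA] : [/\ block a \in A, block c \in A, block b \notin A & block d \notin A].
  move: (bab A AE) (bad A AE) (bcb A AE) ltA.
  by case: (_ a \in A); case: (_ b \in A); case: (_ c \in A); case: (_ d \in A) => //=; clear; lia.
(* The base through [a] and [b] meets the bound of [A] with equality. *)
have mA : (m A).+1 = t * rank M A.
  by move: (bab A AE) ltA; rewrite aA cA (negbTE bA); clear; lia.
have pneq x y : block x \in E -> block y \in E -> block x \in A -> block y \notin A ->
    p (block x) != p (block y).
  by move=> xE yE xA; apply: contra => /eqP/(pI _ _ xE yE) <-.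
have nc' : between (block_lexi p) a b c = between p (block a) (block b) (block c).
  by rewrite between_block_lexi //; [|rewrite eq_sym]; apply: pneq.
have nc'' : between (block_lexi p) a d c = between p (block a) (block d) (block c).
  by rewrite between_block_lexi //; [|rewrite eq_sym]; apply: pneq.
rewrite {}nc' {}nc''.
have [<-|nac'] := eqVneq (block a) (block c); first by rewrite !between_refl.
have [<-//|nbd'] := eqVneq (block b) (block d).
have mD (Y Z : {set T}) : Y \subset Z -> Z \subset E -> m Z = m Y + m (Z :\: Y).
  move=> YZ ZE; rewrite /m !card_blow_up_cap ?(subset_trans YZ) //; last first.
    exact: subset_trans (subsetDl _ _) ZE.
  by rewrite (big_setID Y) /= (setIidPr YZ).
have [S1 [_ S1A par1]] : exists S1 : {set T}, [/\ set0 \subset S1, S1 \subset A :|: set0 &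
    parallel_over M S1 (block a) (block c)].
  (* In a separation both parts of [A] would hold one of [a], [c] within their bounds, so that
     [m A + 2 <= t * rank M A]. *)
  apply: parallel_of_connected => // Y YA aY cY; rewrite !setU0 rank0 addn0.
  have YE := subset_trans YA AE.
  have DE : A :\: Y \subset E by apply: subset_trans (subsetDl _ _) AE.
  have := bab Y YE; have := bcb _ DE; rewrite !inE aY cY cA /= (negbTE bA) andbF.
  have := mD _ _ YA AE; rewrite ltnNge => e h1 h2; apply/negP => le.
  have := leq_mul (leqnn t) le; move: h1 h2 e mA; rewrite mulnDr.
  by case: (_ \in Y); clear; lia.
have [S2 [AS2 S2E par2]] : exists S2 : {set T}, [/\ A \subset S2, S2 \subset (E :\: A) :|: A &
    parallel_over M S2 (block b) (block d)].
  (* For a separation [Y], the bounds of [Y :|: A] (base through [a, b]) and of [E :\: Y] (base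
     through [a, d]) cover counts adding up to [t * r(A) + t * r(E) + 1], one too many. *)
  apply: parallel_of_connected; rewrite ?inE ?bE ?bA ?dE ?dA // => Y YDA bY dY.
  have YE := subset_trans YDA (subsetDl _ _).
  have YAE : Y :|: A \subset E by rewrite subUset YE.
  have eZ : (E :\: A :\: Y) :|: A = E :\: Y.
    apply/setP => z; rewrite !inE; case zA: (z \in A) => /=; last by rewrite orbF.
    rewrite (subsetP AE z zA) !andbT orbT; apply/esym/negP => zY.
    by move/subsetP/(_ z zY): YDA; rewrite !inE zA.
  have -> : (E :\: A) :|: A = E by rewrite setUC -[RHS](setID _ A) (setIidPr AE).
  rewrite eZ.
  have DE : E :\: Y \subset E by apply: subsetDl.
  have aY : block a \notin Y.
    by apply/negP => aY; move/subsetP/(_ _ aY): YDA; rewrite !inE aA.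
  have := bab _ YAE; have := bad _ DE; rewrite !inE aA bY dY aE dE aY orbT /=.
  have YAY : Y \subset Y :|: A := subsetUl _ _.
  have := mD _ _ YE (subxx E); have := mD _ _ (subsetUr Y A) YAE.
  have -> : (Y :|: A) :\: A = Y.
    apply/setP => z; rewrite !inE; case zY: (z \in Y); rewrite ?orbF ?andNb //= andbT.
    by move/subsetP/(_ z zY): YDA; rewrite !inE => /andP[].
  have mE : (m E).+2 = t * rank M E.
    by rewrite /m (setIidPl XE) eX rank_expansion.
  rewrite ltnNge => e1 e2 h1 h2; apply/negP => le.
  have := leq_mul (leqnn t) le; move: h1 h2 e1 e2 mA mE; rewrite !mulnDr.
  by clear; lia.
have AE' : (E :\: A) :|: A = E by rewrite setUC -[RHS](setID _ A) (setIidPr AE).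
rewrite AE' in S2E; rewrite setU0 in S1A.
by apply: (noncrossing_parallel nc par1 par2); rewrite ?(subset_trans S1A) ?(subsetP AS2).
Qed.
End Expansion.

(** * Rank functions on cyclic intervals *)

(* [rho a b] is the rank of the cyclic interval of positions [a, ..., b - 1]   *)
(* modulo [n].                                                                 *)
Record cyclic_rank (n r : nat) (rho : nat -> nat -> nat) : Prop := CyclicRank {
  crank0 : forall a, rho a a = 0;
  crank1 : forall a, rho a a.+1 <= 1;
  crank_total : forall a, rho a (a + n) = r;
  crank_period : forall a b, rho (a + n) (b + n) = rho a b;
  crankSr : forall a b, a <= b < a + n -> rho a b <= rho a b.+1;
  crankSl : forall a b, a < b <= a + n -> rho a.+1 b <= rho a b;
  crank_submod : forall a b c d, a <= b -> b <= c -> c <= d -> d <= a + n ->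
    rho a d + rho b c <= rho a c + rho b d
}.

Definition cyclic_count (n : nat) (chi : nat -> bool) (a b : nat) : nat :=
  \sum_(a <= k < b) chi (k %% n).

(** Among indicators with [r] ones, these are the bases of the positroid encoded by [rho], as
    [cyclic_rank_realizable] makes precise. *)
Definition bounded_by (n : nat) (rho : nat -> nat -> nat) (chi : nat -> bool) : Prop :=
  forall a b, a <= b <= a + n -> cyclic_count n chi a b <= rho a b.

Section Count.
Variables (n : nat) (chi : nat -> bool).
Local Notation cnt := (cyclic_count n chi).

Lemma countnn a : cnt a a = 0.
Proof. by rewrite /cyclic_count big_geq. Qed.

Lemma countSr a b : a <= b -> cnt a b.+1 = cnt a b + chi (b %% n).
Proof. by move=> ab; rewrite /cyclic_count big_nat_recr. Qed.

Lemma countSl a b : a < b -> cnt a b = chi (a %% n) + cnt a.+1 b.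
Proof. by move=> ab; rewrite /cyclic_count big_ltn. Qed.

Lemma count_cat a b c : a <= b -> b <= c -> cnt a c = cnt a b + cnt b c.
Proof. by move=> ab bc; rewrite /cyclic_count (big_cat_nat ab bc). Qed.

Lemma count_period a b k : cnt (a + k * n) (b + k * n) = cnt a b.
Proof.
rewrite /cyclic_count big_addn addnK; apply: eq_bigr => i _.
by rewrite addnC modnMDl.
Qed.
End Count.

Section CyclicRankTheory.
Variables (n r : nat) (rho : nat -> nat -> nat).
Hypothesis rhoP : cyclic_rank n r rho.

Lemma crank_periodM a b k : rho (a + k * n) (b + k * n) = rho a b.
Proof.
elim: k => [|k IHk]; first by rewrite !mul0n !addn0.
by rewrite mulSn !(addnC n) !addnA (crank_period rhoP).
Qed.

Lemma crank_mod a l : rho a (a + l) = rho (a %% n) (a %% n + l).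
Proof.
by rewrite {1 2}(divn_eq a n) addnC -addnA (addnC _ l) addnA crank_periodM.
Qed.

Lemma crank_congr a b l : a = b %[mod n] -> rho a (a + l) = rho b (b + l).
Proof. by move=> e; rewrite crank_mod e -crank_mod. Qed.

Lemma count_congr chi a b l : a = b %[mod n] ->
  cyclic_count n chi a (a + l) = cyclic_count n chi b (b + l).
Proof.
move=> e; rewrite (divn_eq a n) (divn_eq b n) e -!addnA !(addnC (_ * n)).
by rewrite !count_period.
Qed.

End CyclicRankTheory.

(** * Undoing a bridge between adjacent positions *)

Section Bridge.
Variables (n r i : nat) (rho : nat -> nat -> nat).
Hypothesis rhoP : cyclic_rank n r rho.
Hypothesis i_lt : i.+1 < n.
Hypothesis no_loop : forall a, 0 < rho a a.+1.
Hypothesis no_coloop : forall a, rho a.+1 (a + n) = r.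

Definition at_pos (a : nat) : bool := a %% n == i.+1.

(* Subtracting from column [i + 1] the largest admissible multiple of column   *)
(* [i] lowers the rank of the intervals starting at [i + 1] that span column   *)
(* [i], unless column [i + 1] is spanned by the rest of the interval.          *)
Definition bridge_drop (a b : nat) : bool :=
  [&& at_pos a, a < b < a + n, rho a.-1 b == rho a b & rho a.+1 b < rho a b].

Definition unbridge (a b : nat) : nat := rho a b - bridge_drop a b.

Lemma at_pos_gt0 a : at_pos a -> 0 < a.
Proof. by rewrite /at_pos; case: a => //; rewrite mod0n. Qed.

Lemma unbridgeE a b : unbridge a b + bridge_drop a b = rho a b.
Proof.
rewrite /unbridge subnK //; case e: (bridge_drop a b) => //.
by case/and4P: e => _ _ _; apply: leq_ltn_trans.
Qed.

Lemma at_pos_period a : at_pos (a + n) = at_pos a.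
Proof. by rewrite /at_pos modnDr. Qed.

Lemma at_pos_eq a b : at_pos a -> at_pos b -> a <= b < a + n -> b = a.
Proof.
rewrite /at_pos => /eqP ea /eqP eb /andP[ab ba].
have: b - a = 0 %[mod n].
  by apply/eqP; rewrite -(eqn_modDr a) subnK // add0n ea eb.
rewrite mod0n modn_small => [|]; by move: ab ba; clear; lia.
Qed.

(** Only windows starting at [i + 1] lose rank, and two different such starts never fit in one turn
    of the circle, so at most one of the starts in a submodular inequality is affected. The absence
    of loops and coloops settles the empty and the full windows. *)
Lemma unbridge_rank : cyclic_rank n r unbridge.
Proof.
have [r0 r1 rt rp rSr rSl rS] := rhoP.
split.
- by move=> a; rewrite /unbridge r0.
- by move=> a; apply: leq_trans (leq_subr _ _) (r1 a).
- by move=> a; rewrite /unbridge /bridge_drop ltnn !andbF /= subn0.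
- move=> a b; rewrite /unbridge /bridge_drop at_pos_period rp.
  have [ap|] := boolP (at_pos a) => //=.
  have a0 := at_pos_gt0 ap.
  have -> : (a + n).-1 = a.-1 + n by rewrite -!subn1 addnBAC.
  by rewrite -!addSn !rp !ltn_add2r.
- move=> a b /andP[ab ba].
  have eb := unbridgeE a b; have eb' := unbridgeE a b.+1.
  have leab : rho a b <= rho a b.+1 by rewrite rSr ?ab.
  have [lt|le] := ltnP (rho a b) (rho a b.+1).
    have := leq_b1 (bridge_drop a b.+1); move: eb eb' lt; clear; lia.
  (* When the rank grows a drop of one is harmless; otherwise the shorter window must drop along
     with the longer one. *)
  suff : bridge_drop a b.+1 -> bridge_drop a b.
    by move: eb eb' leab; do 2!case: bridge_drop => //; clear; lia.
  rewrite /bridge_drop => /and4P[ap /andP[ab1 b1a] /eqP e1 lt2].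
  have a0 := at_pos_gt0 ap; have e : rho a b.+1 = rho a b by apply/eqP; rewrite eqn_leq le.
  have [a' ea] : exists a', a = a'.+1 by exists a.-1; rewrite prednK.
  move: ab ba ab1 b1a e1 lt2 e; rewrite ea /= => ab ba ab1 b1a e1 lt2 e.
  have m1 : rho a' b <= rho a' b.+1 by apply: rSr; move: ab ba b1a; clear; lia.
  have m2 : rho a'.+1 b <= rho a' b by apply: rSl; move: ab b1a; clear; lia.
  rewrite -ea ap ea ba eqn_leq m2 -e -e1 m1 !andbT /=.
  have ltab : a' < b.-1.
    have := no_loop a'; move: ab; rewrite leq_eqVlt => /orP[/eqP eb0|]; last by clear; lia.
    by move: m1 e1 e; rewrite -eb0 r0; clear; lia.
  have m3 : rho a'.+2 b <= rho a'.+2 b.+1 by apply: rSr; move: ltab b1a; clear; lia.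
  apply/andP; split; first by move: ltab; clear; lia.
  by rewrite e1 (leq_ltn_trans m3).
- move=> a b /andP[ab ba].
  have eb := unbridgeE a b; have eb' := unbridgeE a.+1 b.
  have := rSl a b; rewrite ab ba => /(_ isT).
  case e: (bridge_drop a b) eb => eb; last by move: eb eb'; clear; lia.
  by case/and4P: e => _ _ _; move: eb eb'; clear; lia.
move=> a b c d ab bc cd da.
have [<-|nab] := eqVneq a b; first by rewrite addnC.
have [->|ncd] := eqVneq c d; first by [].
have {nab} ltab : a < b by rewrite ltn_neqAle nab.
have {ncd} ltcd : c < d by rewrite ltn_neqAle ncd.
have e1 := unbridgeE a c; have e2 := unbridgeE b d.
have e3 := unbridgeE a d; have e4 := unbridgeE b c.
have S0 := rS a b c d ab bc cd da.
case dac: (bridge_drop a c) e1 => e1.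
  have /and4P[ap /andP[ac ca] /eqP l1 l2] := dac.
  have dbd : bridge_drop b d = false.
    apply/negP => /and4P[bp _ _ _]; have := at_pos_eq ap bp.
    by move: ltab bc ltcd da; clear; lia.
  rewrite dbd in e2; case dad: (bridge_drop a d) e3 => e3.
    by move: e1 e2 e3 e4 S0; clear; lia.
  suff le : rho a d <= rho a.+1 d.
    have := rS a.+1 b c d ltab bc cd (leq_trans da (leqnSn _)).
    by move: e1 e2 e3 e4 l2 le; clear; lia.
  have [dan|nda] := ltnP d (a + n); last first.
    have -> : d = a + n by apply/eqP; rewrite eqn_leq da.
    by rewrite rt no_coloop.
  have a0 := at_pos_gt0 ap.
  move: dad; rewrite /bridge_drop ap (ltn_trans ac ltcd) dan /= => /negbT.
  rewrite negb_and -leqNgt => /orP[/negP[]|//].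
  have := rS a.-1 a c d; have := rSl a.-1 d; rewrite prednK //.
  by move: l1 a0 ac cd dan; clear; lia.
case dbd: (bridge_drop b d) e2 => e2; last by move: e1 e2 e3 e4 S0; clear; lia.
case dbc: (bridge_drop b c) e4 => e4; first by move: e1 e2 e3 e4 S0; clear; lia.
case/and4P: dbd => bp /andP[bd db] /eqP l1 l2.
have b0 := at_pos_gt0 bp.
suff lt : rho b c < rho b.-1 c.
  have := rS a b.-1 c d; move: ltab b0 bc cd da lt l1 e1 e2 e3 e4; clear; lia.
have [cb|nbc] := eqVneq c b.
  by rewrite cb r0 -{2}(prednK b0) no_loop.
have ltbc : b < c by rewrite ltn_neqAle eq_sym nbc.
move: dbc; rewrite /bridge_drop bp ltbc (ltn_trans ltcd db) /= => /negbT.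
have := rS b b.+1 c d; have := rSl b.-1 c; rewrite prednK // negb_and.
move: l2 ltab ltbc ltcd da db; clear; case: eqP => /=; lia.
Qed.
Lemma at_posS b : at_pos b.+1 = (b %% n == i).
Proof.
have n0 : 0 < n by apply: leq_ltn_trans i_lt.
have lt := ltn_pmod b n0.
rewrite /at_pos -addn1 -modnDml addn1.
have [e|ne] := eqVneq (b %% n).+1 n; last by rewrite modn_small // ltn_neqAle ne.
by rewrite e modnn; move: e i_lt; clear; lia.
Qed.

(** The set with [i + 1] traded for [i]: it indexes the second minor in the expansion used by
    [realize_bridge]. *)
Definition swap_pos (chi : nat -> bool) (k : nat) : bool :=
  if k == i then true else if k == i.+1 then false else chi k.

Lemma swap_pos_i chi : swap_pos chi i = true.
Proof. by rewrite /swap_pos eqxx. Qed.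

Lemma swap_pos_i1 chi : swap_pos chi i.+1 = false.
Proof. by rewrite /swap_pos eqxx gtn_eqF. Qed.

(** The trade is visible only to a window that starts at [i + 1] or stops just before it. *)
Lemma count_swap chi a b : ~~ chi i -> chi i.+1 -> a <= b ->
  cyclic_count n (swap_pos chi) a b + at_pos a = cyclic_count n chi a b + at_pos b.
Proof.
move=> ci ci1; elim: b => [|b IHb]; first by rewrite leqn0 => /eqP ->; rewrite !countnn.
rewrite leq_eqVlt => /orP[/eqP <-|]; first by rewrite !countnn.
rewrite ltnS => ab; rewrite !countSr // addnAC IHb // -!addnA; congr (_ + _).
rewrite at_posS /at_pos /swap_pos.
have [->|_] := eqVneq (b %% n) i; first by rewrite (negbTE ci) ltn_eqF.
by have [->|_] := eqVneq (b %% n) i.+1; rewrite ?ci1 //= addn0.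
Qed.

(** The combinatorial shadow of adding column [i] to column [i + 1]. If [chi] violates [unbridge],
    the offending window is tight for [rho]; this forces [i + 1] in and [i] out, and submodularity
    against that window makes room for the trade. *)
Lemma bounded_unbridge chi (l0 : nat) :
  (forall a, at_pos a -> bridge_drop a (a + l0)) ->
  bounded_by n rho chi <->
  bounded_by n unbridge chi \/
    [/\ chi i.+1, ~~ chi i & bounded_by n unbridge (swap_pos chi)].
Proof.
have [r0 r1 rt rp rSr rSl rS] := rhoP.
have le_unbridge a b : unbridge a b <= rho a b by apply: leq_subr.
have n0 : 0 < n by apply: leq_ltn_trans i_lt.
move=> hl0; split; last first.
  case=> [h a b ab|[ci1 ci h a b ab]]; first exact: leq_trans (h a b ab) _.
  have /andP[leab leba] := ab.
  have := count_swap ci ci1 leab; have := h a b ab; have := unbridgeE a b.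
  have [ap|_] := boolP (at_pos a); last by clear; lia.
  have [bp|nbp] := boolP (at_pos b); first by clear; lia.
  have ltab : a < b by rewrite ltn_neqAle leab andbT; apply: contra nbp => /eqP <-.
  have ltba : b < a + n.
    rewrite ltn_neqAle leba andbT; apply: contra nbp => /eqP ->.
    by rewrite at_pos_period.
  move=> _ hab e; suff : (cyclic_count n (swap_pos chi) a b).+1 <= rho a b.
    by move: e; clear; lia.
  have a0 := at_pos_gt0 ap.
  have ltan : a.-1 < a by rewrite prednK.
  have /eqP ai : a.-1 %% n == i by rewrite -at_posS prednK.
  have /eqP ai1 : a %% n == i.+1 by [].
  have [lt3|ge3] := ltnP (rho a.+1 b) (rho a b).
    have : cyclic_count n (swap_pos chi) a.+1 b <= unbridge a.+1 b.
      by apply: h; move: ltab ltba; clear; lia.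
    rewrite [X in X < _](countSl _ _ ltab) ai1 swap_pos_i1 => le.
    exact: leq_ltn_trans (leq_trans le (le_unbridge _ _)) lt3.
  have [e1|ne1] := eqVneq (rho a.-1 b) (rho a b).
    have : cyclic_count n (swap_pos chi) a.-1 b <= unbridge a.-1 b.
      by apply: h; move: ltab ltba a0; clear; lia.
    rewrite (@countSl _ _ a.-1) ?(ltn_trans ltan) // prednK // ai swap_pos_i => le.
    by rewrite -e1; apply: leq_trans le (le_unbridge _ _).
  (* Neither shrinking nor extending the window at its left end helps; the drop at length [l0] then
     contradicts submodularity, whether that window is the shorter or the longer. *)
  have /and4P[_ /andP[lt1 lt2] /eqP e1 lt3] := hl0 a ap.
  have m1 : rho a b <= rho a.-1 b.
    by have := rSl a.-1 b; rewrite prednK //; apply; move: ltab a0 ltba; clear; lia.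
  have {ne1 m1} lt4 : rho a b < rho a.-1 b by rewrite ltn_neqAle eq_sym ne1.
  have [lel|ltl] := leqP (a + l0) b.
    by have := rS a.-1 a (a + l0) b; move: e1 lt4 lt1 lel ltba a0; clear; lia.
  have := rS a a.+1 b (a + l0); move: lt3 ge3 ltl lt2 ltab ltba; clear; lia.
move=> h.
have uP := unbridge_rank.
pose okb := [forall a : 'I_n, forall l : 'I_n.+1,
  cyclic_count n chi a (a + l) <= unbridge a (a + l)].
have [/forallP ok|] := boolP okb.
  left=> a b /andP[ab ba]; have -> : b = a + (b - a) by rewrite subnKC.
  have lt : b - a < n.+1 by move: ab ba; clear; lia.
  rewrite (crank_mod uP) (count_congr chi _ (esym (modn_mod a n))).
  by have /forallP/(_ (Ordinal lt)) := ok (Ordinal (ltn_pmod a n0)).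
rewrite negb_forall => /existsP[a0]; rewrite negb_forall => /existsP[l0'].
rewrite -ltnNge; move: (nat_of_ord a0) (nat_of_ord l0') (ltn_ord l0') => a l ltl viol.
right.
have hal : cyclic_count n chi a (a + l) <= rho a (a + l).
  by apply: h; move: ltl; clear; lia.
have dal : bridge_drop a (a + l).
  by have := unbridgeE a (a + l); move: viol hal; case: bridge_drop => //; clear; lia.
have eal : cyclic_count n chi a (a + l) = rho a (a + l).
  by have := unbridgeE a (a + l); move: viol hal; rewrite dal; clear; lia.
have /and4P[ap /andP[lt1 lt2] /eqP e1 lt3] := dal.
have a1 := at_pos_gt0 ap.
have ltan : a.-1 < a by rewrite prednK.
have /eqP ai : a.-1 %% n == i by rewrite -at_posS prednK.
have /eqP ai1 : a %% n == i.+1 by [].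
have ci1 : chi i.+1.
  apply: contraTT lt3 => /negbTE ci1; rewrite -leqNgt -eal (countSl _ _ lt1) ai1 ci1.
  by apply: h; move: lt1 lt2; clear; lia.
have ci : ~~ chi i.
  apply/negP => ci; have : cyclic_count n chi a.-1 (a + l) <= rho a.-1 (a + l).
    by apply: h; move: lt1 lt2 a1; clear; lia.
  by rewrite e1 (countSl _ _ (ltn_trans ltan lt1)) prednK // ai ci eal ltnn.
split=> // x y /andP[xy yx].
have := count_swap ci ci1 xy; have hxy : cyclic_count n chi x y <= rho x y.
  by apply: h; rewrite xy.
have := unbridgeE x y; have [xp|xnp] := boolP (at_pos x).
  have [yp|ynp] := boolP (at_pos y); last by move: hxy; case: bridge_drop; clear; lia.
  suff -> : bridge_drop x y = false by move: hxy; clear; lia.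
  apply/negP => /and4P[_ /andP[ltxy ltyx] _ _].
  by have := at_pos_eq xp yp; move: ltxy ltyx; clear; lia.
rewrite {1}/bridge_drop (negbTE xnp) /=.
have [yp|ynp] := boolP (at_pos y); last by move: hxy; clear; lia.
have ltxy : x < y by rewrite ltn_neqAle xy andbT; apply: contra xnp => /eqP ->.
have ltyx : y < x + n.
  rewrite ltn_neqAle yx andbT; apply: contra xnp => /eqP e.
  by move: yp; rewrite e at_pos_period.
have eya : y = a %[mod n] by move: yp; rewrite /at_pos ai1 => /eqP.
have ltln : 0 < l < n by move: lt1 lt2; clear; lia.
have cy : cyclic_count n chi y (y + l) = rho y (y + l).
  by rewrite (count_congr chi l eya) (crank_congr rhoP l eya).
have dy : unbridge y (y + l) < rho y (y + l).
  rewrite (crank_congr rhoP l eya) (crank_congr uP l eya).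
  by have := unbridgeE a (a + l); rewrite dal; clear; lia.
have uxE z : unbridge x z = rho x z.
  by have := unbridgeE x z; rewrite /bridge_drop (negbTE xnp) addn0.
rewrite uxE => _ e.
suff : (cyclic_count n chi x y).+1 <= rho x y by move: e; clear; lia.
(* The window from [x] to [y] either joins the tight one starting at [y] within one turn, or the two
   overlap after going around. *)
have [le|gt] := leqP (y + l) (x + n).
  have := h x (y + l); rewrite (@count_cat _ _ x y) ?leq_addr // cy.
  have := crank_submod uP (ltnW ltxy) (leqnn y) (leq_addr l y) le.
  by rewrite !uxE (crank0 uP); move: dy ltxy le; clear; lia.
have xnE z : unbridge (x + n) (z + n) = rho x z by rewrite (crank_period uP) uxE.
have := h (x + n) (y + l); have := h x (x + n); rewrite rt.
have -> : cyclic_count n chi x (x + n) =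
    cyclic_count n chi x y + cyclic_count n chi y (x + n) by rewrite -count_cat // ltnW.
have := @count_cat n chi y (x + n) (y + l) (ltnW ltyx) (ltnW gt).
have ltyl : y + l <= y + n by move: ltln; clear; lia.
have := crank_submod uP (ltnW ltyx) (ltnW gt) ltyl (leqnn _).
rewrite xnE (crank_total uP) cy.
have : unbridge (x + n) (y + l) = rho (x + n) (y + l).
  by have := unbridgeE (x + n) (y + l); rewrite /bridge_drop at_pos_period (negbTE xnp) addn0.
by move=> ->; move: dy ltln ltxy gt ltyl ltyx; clear; lia.
Qed.
End Bridge.

Section ExistsBridge.
Variables (n r : nat) (rho : nat -> nat -> nat).
Hypothesis rhoP : cyclic_rank n r rho.
Hypothesis no_loop : forall a, 0 < rho a a.+1.
Hypothesis no_coloop : forall a, rho a.+1 (a + n) = r.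

(** If no window from [i + 1] to [n] dropped, the full rank [r] would persist on the windows from
    [k] to [n] until the empty one, making [n - 1] a loop. *)
Lemma exists_bridge : 1 < n -> exists i l, [/\ i.+1 < n, l < n &
  forall a, at_pos n i a -> bridge_drop n i rho a (a + l)].
Proof.
move=> n1; have [r0 r1 rt rp rSr rSl rS] := rhoP.
have [/existsP[[i /= ltin] drop]|] := boolP [exists i : 'I_n.-1, bridge_drop n i rho i.+1 n].
  have lti : i.+1 < n by move: ltin n1; clear; lia.
  exists i, (n - i.+1); split=> //; first by move: lti; clear; lia.
  move=> a ap; have a0 := at_pos_gt0 ap.
  have ai : a = i.+1 %[mod n] by rewrite (modn_small lti); move: ap => /eqP.
  have ai' : a.-1 = i %[mod n].
    by rewrite (modn_small (ltnW lti)); apply/eqP; rewrite -at_posS // prednK.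
  have ai'' : a.+1 = i.+2 %[mod n] by rewrite -addn1 -modnDml ai modnDml addn1.
  have e1 := crank_congr rhoP (n - i.+1).+1 ai'.
  have e2 := crank_congr rhoP (n - i.+1) ai.
  have e3 := crank_congr rhoP (n - i.+2) ai''.
  have k1 : a.-1 + (n - i.+1).+1 = a + (n - i.+1) by move: a0; clear; lia.
  have k2 : a.+1 + (n - i.+2) = a + (n - i.+1) by move: lti; clear; lia.
  have k3 : i + (n - i.+1).+1 = n by move: lti; clear; lia.
  have k4 : i.+1 + (n - i.+1) = n by move: lti; clear; lia.
  have k5 : i.+2 + (n - i.+2) = n by move: lti; clear; lia.
  rewrite k1 k3 in e1; rewrite k4 in e2; rewrite k2 k5 in e3.
  move: drop; rewrite /bridge_drop ap e1 e2 e3 /= => /and4P[_ _ -> ->].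
  by rewrite !andbT; move: lti; clear; lia.
move=> /existsPn no.
have step k : k < n -> rho k n = r /\ rho k.+1 n = r.
  elim: k => [_|k IHk ltk]; first by rewrite -{1}(add0n n) rt -{1}(add0n n) no_coloop.
  have [e1 e2] := IHk (ltnW ltk); split=> //.
  have ltk' : k < n.-1 by move: ltk; clear; lia.
  have := no (Ordinal ltk'); rewrite /bridge_drop /= /at_pos modn_small // eqxx ltk.
  rewrite e1 e2 eqxx /= negb_and -leqNgt => /orP[|le].
    by move: ltk; clear; lia.
  by have := rSl k.+1 n; rewrite ltk leq_addl e2 => /(_ isT); move: le; clear; lia.
have [|e1 e2] := step n.-1; first by rewrite prednK // ltnW.
rewrite prednK ?(ltnW n1) // r0 in e2.
by have := no_loop n.-1; rewrite prednK ?(ltnW n1) // e1 -e2.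
Qed.

(** The measure that decreases each time a bridge is undone. *)
Definition rank_sum (rho' : nat -> nat -> nat) : nat :=
  \sum_(a < n) \sum_(l < n) rho' a (a + l).

Lemma rank_sum_unbridge i l : i.+1 < n -> l < n ->
  (forall a, at_pos n i a -> bridge_drop n i rho a (a + l)) ->
  rank_sum (unbridge n i rho) < rank_sum rho.
Proof.
move=> lti ltl drop; rewrite /rank_sum.
have le a b : unbridge n i rho a b <= rho a b by apply: leq_subr.
rewrite (bigD1 (Ordinal lti)) // [X in _ < X](bigD1 (Ordinal lti)) //=.
rewrite -addSn leq_add //; last by apply: leq_sum => a _; apply: leq_sum.
rewrite (bigD1 (Ordinal ltl)) // [X in _ < X](bigD1 (Ordinal ltl)) //=.
rewrite -addSn leq_add //; last by apply: leq_sum.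
rewrite /unbridge drop; last by rewrite /at_pos modn_small.
have := drop i.+1; rewrite /at_pos modn_small // eqxx => /(_ isT) /and4P[_ _ _].
by clear; lia.
Qed.
End ExistsBridge.

(** * Deleting a loop or a coloop *)

Section Deletion.
Variables (m r c : nat) (kappa : bool) (rho : nat -> nat -> nat).
Local Notation n := m.+1.
Hypothesis rhoP : cyclic_rank n r rho.
Hypothesis m_gt0 : 0 < m.
Hypothesis c_lt : c < n.
(* [c] is a loop if [kappa] is false and a coloop if [kappa] is true.          *)
Hypothesis rho_r : forall x y, x %% n = c -> y <= x < y + n ->
  rho y x.+1 = rho y x + kappa.
Hypothesis rho_l : forall x y, x %% n = c -> x < y <= x + n ->
  rho x y = kappa + rho x.+1 y.

(* Cut points of the circle without [c] are sent to cut points of the circle   *)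
(* with [c]; the cut just before [c] is avoided.                               *)
Definition skip (k : nat) : nat := k %/ m * n + bump c (k %% m).

(** The number of times the window from [skip a] to [skip b] passes over [c]. *)
Definition skips (a b : nat) : nat := (skip b - skip a) - (b - a).

Definition delete_pos (a b : nat) : nat := rho (skip a) (skip b) - kappa * skips a b.

Lemma bump_lt k : bump c (k %% m) < n.
Proof. by rewrite /bump; have := ltn_pmod k m_gt0; case: leqP; clear; lia. Qed.

Lemma skip_mod k : skip k %% n = bump c (k %% m).
Proof. by rewrite /skip modnMDl modn_small ?bump_lt. Qed.

Lemma skip_period k : skip (k + m) = skip k + n.
Proof. by rewrite /skip divnDr // divnn m_gt0 modnDr mulnDl mul1n addnAC. Qed.

Lemma skipS k : skip k.+1 = (skip k).+1 + ((skip k).+1 %% n == c).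
Proof.
have ltk := ltn_pmod k m_gt0.
have -> : (skip k).+1 %% n = (bump c (k %% m)).+1 %% n.
  by rewrite -addn1 -modnDml skip_mod addn1.
have [e|ne] := eqVneq (k %% m).+1 m; last first.
  have lt : (k %% m).+1 < m by rewrite ltn_neqAle ne.
  have ed : k.+1 = k %/ m * m + (k %% m).+1 by rewrite addnS -divn_eq.
  rewrite /skip {1 2}ed divnMDl // (divn_small lt) addn0 modnMDl (modn_small lt).
  have -> : (bump c (k %% m)).+1 %% n = (bump c (k %% m)).+1.
    by rewrite modn_small // /bump; case: leqP; move: lt; clear; lia.
  by rewrite /bump; case: leqP; case: leqP => //=; move: lt; clear; lia.
have ed : k.+1 = (k %/ m).+1 * m by rewrite {1}(divn_eq k m) -addnS e mulSn addnC.
rewrite /skip {1 2}ed mulnK // modnMl mulSn.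
have es : k %% m = m.-1 by move: e; clear; lia.
rewrite es /bump; have [lec|gtc] := leqP c m.-1.
  have -> : (true + m.-1).+1 = n by rewrite add1n prednK.
  rewrite modnn; case: c => [|c'] /=; move: m_gt0; clear; nia.
have -> : c = m by move: c_lt gtc; clear; lia.
rewrite add0n prednK // modn_small // eqxx leqn0 (gtn_eqF m_gt0).
by move: m_gt0; clear; nia.
Qed.

Lemma skip_lt a b : a < b -> skip a < skip b.
Proof.
elim: b => // b IHb; rewrite ltnS leq_eqVlt => /orP[/eqP->|/IHb lt].
  by rewrite skipS; clear; lia.
by rewrite skipS; apply: leq_trans lt _; clear; lia.
Qed.

Lemma skip_le a b : a <= b -> skip a <= skip b.
Proof. by rewrite leq_eqVlt => /orP[/eqP->|/skip_lt/ltnW]. Qed.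

Lemma skip_leE a b : (skip a <= skip b) = (a <= b).
Proof. by case: (leqP a b) => [/skip_le //|/skip_lt lt]; rewrite leqNgt lt. Qed.

Lemma skipsE a b : a <= b -> skip b + a = skip a + b + skips a b.
Proof.
move=> ab; suff : skip a + (b - a) <= skip b by rewrite /skips; move: ab; clear; lia.
move: ab; elim: b => [|b IHb]; first by rewrite leqn0 => /eqP->; rewrite addn0.
rewrite leq_eqVlt => /orP[/eqP->|]; first by rewrite subnn addn0.
by rewrite ltnS => ab; have := IHb ab; rewrite skipS; move: ab; clear; lia.
Qed.

Lemma skip_surj x : x %% n != c -> exists a, skip a = x.
Proof.
move=> xc; have ltx := ltn_pmod x (ltn0Sn m).
exists (x %/ n * m + unbump c (x %% n)).
have ltu : unbump c (x %% n) < m.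
  by rewrite /unbump; move: xc ltx c_lt; case: ltnP; clear; lia.
rewrite /skip divnMDl // (divn_small ltu) addn0 modnMDl (modn_small ltu).
by rewrite unbumpKcond (negbTE xc) -divn_eq.
Qed.

Let skip_range a b : a <= b <= a + m -> skip a <= skip b <= skip a + n.
Proof. by case/andP=> ab ba; rewrite skip_le //= -skip_period skip_le. Qed.

Let stepr a b : a <= b < a + m ->
  rho (skip a) (skip b) + kappa * ((skip b).+1 %% n == c) <= rho (skip a) (skip b.+1) <=
  1 + rho (skip a) (skip b) + kappa * ((skip b).+1 %% n == c).
Proof.
case/andP=> ab ba; have [r0 r1 rt rp rSr rSl rS] := rhoP.
have /andP[h1 h2] : skip a <= skip b.+1 <= skip a + n.
  by apply: skip_range; move: ab ba; clear; lia.
have sab := skip_le ab; rewrite skipS in h2 *.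
have l1 : rho (skip a) (skip b) <= rho (skip a) (skip b).+1.
  by apply: rSr; move: sab h2; clear; lia.
have l2 := rS (skip a) (skip b) (skip b) (skip b).+1 sab (leqnn _) (leqnSn _).
have l3 := r1 (skip b); have l4 := r0 (skip b).
have [e|ne] := eqVneq ((skip b).+1 %% n) c; last first.
  rewrite muln0 !addn0; move: l1 l2 l3 l4 h2 sab; clear; lia.
rewrite e eqxx addn1 in h2 *; rewrite muln1.
rewrite (rho_r e); last by move: sab h2; clear; lia.
by move: l1 l2 l3 l4 h2; clear; lia.
Qed.

Let kappa_skips a b : a <= b <= a + m ->
  kappa * skips a b <= rho (skip a) (skip b).
Proof.
case/andP; elim: b => [|b IHb] ab ba.
  by move: ab; rewrite leqn0 => /eqP ->; rewrite /skips !subnn muln0.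
move: ab; rewrite leq_eqVlt => /orP[/eqP->|]; first by rewrite /skips !subnn muln0.
rewrite ltnS => ab.
have := IHb ab (ltnW ba); have := @stepr a b; rewrite ab ba => /(_ isT).
have := skipsE ab; have := skipsE (leqW ab); rewrite skipS.
set J := (_ == c); move=> e1 e2.
have -> : skips a b.+1 = skips a b + J by move: e1 e2; clear; lia.
by clear; lia.
Qed.

Lemma delete_posE a b : a <= b <= a + m ->
  delete_pos a b + kappa * skips a b = rho (skip a) (skip b).
Proof. by move=> ab; rewrite subnK // kappa_skips. Qed.

(** Each passage over [c] contributes exactly [kappa], so the axioms transfer along [skip] once
    these contributions are subtracted. *)
Lemma delete_rank : cyclic_rank m (r - kappa) delete_pos.
Proof.
have [r0 r1 rt rp rSr rSl rS] := rhoP.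
have sS a b : a <= b -> skips a b.+1 = skips a b + ((skip b).+1 %% n == c).
  move=> ab; have := skipsE ab; have := skipsE (leqW ab); rewrite skipS.
  by clear; lia.
split.
- by move=> a; rewrite /delete_pos r0.
- move=> a; have := @stepr a a; have := @delete_posE a a.+1; have := r0 (skip a).
  rewrite (sS a a) //; have -> : skips a a = 0 by rewrite /skips !subnn.
  by move: m_gt0; clear; lia.
- move=> a; rewrite /delete_pos skip_period rt; congr (_ - _).
  by rewrite /skips skip_period !addKn subSnn muln1.
- move=> a b; rewrite /delete_pos /skips !skip_period rp; congr (_ - _ * _).
  by rewrite !subnDr.
- move=> a b /andP[ab ba]; have := @stepr a b; rewrite ab ba => /(_ isT).
  have := @delete_posE a b; have := @delete_posE a b.+1; rewrite sS //.
  by rewrite ab (ltnW ba) (leqW ab) ba => /(_ isT) + /(_ isT); rewrite mulnDr; clear; lia.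
- move=> a b /andP[ab ba].
  have := @delete_posE a b; have := @delete_posE a.+1 b.
  rewrite ab (ltnW ab) ba (leq_trans ba) // => /(_ isT) e1 /(_ isT) e2.
  have := skipsE ab; have := skipsE (ltnW ab).
  have /andP[h1 h2] : skip a <= skip b <= skip a + n by rewrite skip_range // ltnW.
  have h3 := skip_le ab; move: e1 e2 h1 h2 h3; rewrite skipS.
  move=> e1 e2 h1 h2 h3 e3 e4.
  have := rSl (skip a) (skip b); have := @rho_l (skip a).+1 (skip b).
  have ltab := skip_lt ab; move: e1 e2 h1 h2 h3 e3 e4; case: eqP => [e|ne].
    have -> : (skip a).+1 + true = (skip a).+2 by rewrite addn1.
    move=> e1 e2 h1 h2 h3 e3 e4.
    have es : skips a b = (skips a.+1 b).+1 by move: e3 e4; clear; lia.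
    rewrite es mulnS in e2.
    by move/(_ e); move: e1 e2 h1 h2 h3; clear; lia.
  have -> : (skip a).+1 + false = (skip a).+1 by rewrite addn0.
  move=> e1 e2 h1 h2 h3 e3 e4 _.
  have es : skips a b = skips a.+1 b by move: e3 e4; clear; lia.
  rewrite es in e2.
  by move: e1 e2 h1 h2 h3 ltab; clear; lia.
move=> a b c' d ab bc cd da.
have ac := leq_trans ab bc; have bd := leq_trans bc cd; have ad := leq_trans ac cd.
have ca := leq_trans cd da; have db : d <= b + m by rewrite (leq_trans da) // leq_add2r.
have cb := leq_trans cd db.
have := rS _ _ _ _ (skip_le ab) (skip_le bc) (skip_le cd).
rewrite -skip_period skip_le // => /(_ isT).
rewrite -!delete_posE ?ad ?bc ?ac ?bd //.
have := skipsE ac; have := skipsE ad; have := skipsE bc; have := skipsE bd.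
by case: kappa; clear; lia.
Qed.

Lemma count_skip chi a b : chi c = kappa -> a <= b ->
  cyclic_count n chi (skip a) (skip b) =
  cyclic_count m (chi \o bump c) a b + kappa * skips a b.
Proof.
move=> cc; elim: b => [|b IHb] ab.
  by move: ab; rewrite leqn0 => /eqP ->; rewrite /skips !subnn !countnn muln0.
move: ab; rewrite leq_eqVlt => /orP[/eqP->|]; first by rewrite /skips !subnn !countnn muln0.
rewrite ltnS => ab; rewrite (@countSr m) //= skipS.
have := skipsE ab; have := skipsE (leqW ab); rewrite skipS.
have sab := skip_le ab; have := IHb ab.
case: eqP => [e|ne] h e1 e2; rewrite ?addn1 ?addn0.
  have -> : skips a b.+1 = (skips a b).+1 by move: e1 e2; clear; lia.
  rewrite !countSr ?(leqW sab) // e cc skip_mod h.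
  by move: (skips a b) => K; rewrite /=; case: (chi _); case: kappa; clear; lia.
have -> : skips a b.+1 = skips a b by move: e1 e2; clear; lia.
rewrite countSr // skip_mod h /=.
by clear; lia.
Qed.

Lemma count_total chi a : cyclic_count n chi a (a + n) = cyclic_count n chi 0 n.
Proof.
elim: a => [|a IHa]; first by rewrite add0n.
have lt : a < a + n by rewrite addnS ltnS leq_addr.
by rewrite addSn countSr // modnDr addnC -countSl.
Qed.

(** The total [r] forces [chi c = kappa], from the window of [c] alone and from its complement.
    Conversely, a window with an end at the cut before [c] is not an image of [skip], but moving
    that end across [c] changes count and rank equally. *)
Lemma bounded_delete chi : cyclic_count n chi 0 n = r ->
  bounded_by n rho chi <->
  chi c = kappa /\ bounded_by m delete_pos (chi \o bump c).
Proof.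
have [r0 r1 rt rp rSr rSl rS] := rhoP.
have cmod : c %% n = c by rewrite modn_small.
move=> tot; split=> [h|[cc h]].
  have cc : chi c = kappa.
    have := h c c.+1; have := h c.+1 (c + n).
    have := @rho_l c (c + n) cmod; have := @rho_r c c cmod.
    have := count_total chi c; rewrite tot (@countSl _ _ c) ?cmod; last by clear; lia.
    rewrite rt r0 countSr // countnn cmod.
    by case: (chi c); case: kappa => //=; clear; lia.
  split=> // a b /andP[ab ba].
  have := delete_posE (introT andP (conj ab ba)); have := count_skip cc ab.
  by have := h _ _ (skip_range (introT andP (conj ab ba))); clear; lia.
have nice x y : x <= y <= x + n -> x %% n != c -> y %% n != c ->
    cyclic_count n chi x y <= rho x y.
  move=> xy /skip_surj[a ea] /skip_surj[b eb].
  have ab : a <= b <= a + m.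
    by move: xy; rewrite -ea -eb -skip_period !skip_leE.
  have /andP[ab' _] := ab; have := count_skip cc ab'; have := h a b ab.
  by have := delete_posE ab; rewrite ea eb; clear; lia.
have modS x : x %% n = c -> x.+1 %% n != c.
  move=> e; rewrite -addn1 -modnDml e addn1.
  have [->|ne] := eqVneq c m; first by rewrite modnn eq_sym -lt0n.
  by rewrite modn_small ?gtn_eqF //; move: ne c_lt; clear; lia.
have niceR x y : x <= y <= x + n -> x %% n != c -> cyclic_count n chi x y <= rho x y.
  move=> xy xc; have [yc|yc] := eqVneq (y %% n) c; last exact: nice.
  have lt : y < x + n.
    rewrite ltn_neqAle; have /andP[_ ->] := xy; rewrite andbT.
    by apply: contra xc => /eqP e; rewrite -yc e modnDr.
  have := nice x y.+1; rewrite modS // xc (rho_r yc); last by have /andP[->] := xy.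
  rewrite countSr; last by have /andP[] := xy.
  by rewrite yc cc; move: xy lt; clear; lia.
move=> x y /andP[]; rewrite leq_eqVlt => /orP[/eqP->|xy] yx; first by rewrite countnn.
have [xc|xc] := eqVneq (x %% n) c; last by apply: niceR; rewrite // ltnW.
rewrite (countSl _ _ xy) xc cc rho_l ?xy // leq_add2l; apply: niceR; last exact: modS.
by rewrite xy (leq_trans yx) // leq_add2r.
Qed.
End Deletion.

Section LoopColoop.
Variables (m r c : nat) (rho : nat -> nat -> nat).
Local Notation n := m.+1.
Hypothesis rhoP : cyclic_rank n r rho.
Hypothesis c_lt : c < n.

Lemma loop_deletable : rho c c.+1 = 0 ->
  (forall x y, x %% n = c -> y <= x < y + n -> rho y x.+1 = rho y x + false) /\
  (forall x y, x %% n = c -> x < y <= x + n -> rho x y = false + rho x.+1 y).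
Proof.
have [r0 r1 rt rp rSr rSl rS] := rhoP.
move=> lc; have loop x : x %% n = c -> rho x x.+1 = 0.
  move=> xc; have e : x = c %[mod n] by rewrite xc modn_small.
  by have := crank_congr rhoP 1 e; rewrite !addn1 lc.
split=> x y xc /andP[h1 h2].
  have l1 := rS y x x x.+1 h1 (leqnn _) (leqnSn _) h2.
  have l2 : rho y x <= rho y x.+1 by rewrite rSr ?h1.
  by move: l1 l2; rewrite loop // r0; clear; lia.
have l1 := rS x x.+1 x.+1 y (leqnSn _) (leqnn _) h1 h2.
have l2 : rho x.+1 y <= rho x y by rewrite rSl ?h1.
by move: l1 l2; rewrite loop // r0; clear; lia.
Qed.

(** Submodularity against the full circle passes the rank lost by omitting [c] on to every window
    with [c] at one end. *)
Lemma coloop_deletable : rho c.+1 (c + n) < r ->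
  (forall x y, x %% n = c -> y <= x < y + n -> rho y x.+1 = rho y x + true) /\
  (forall x y, x %% n = c -> x < y <= x + n -> rho x y = true + rho x.+1 y).
Proof.
have [r0 r1 rt rp rSr rSl rS] := rhoP.
move=> lc; have coloop x : x %% n = c -> rho x.+1 (x + n) < r.
  move=> xc; have e : x.+1 = c.+1 %[mod n].
    by rewrite -(addn1 x) -(addn1 c) -modnDml xc.
  by have := crank_congr rhoP m e; rewrite !addSnnS => ->.
split=> x y xc /andP[h1 h2].
  have l1 := rS y x x x.+1 h1 (leqnn _) (leqnSn _) h2.
  have := rS x.+1 (y + n) (x + n) (x + n).+1; rewrite -addSn rt !rp !leq_add2r.
  move=> /(_ h2 h1 (leqnSn _) (leqnn _)).
  by have := r1 x; have := r0 x; have := coloop x xc; move: l1; clear; lia.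
have l1 := rS x x.+1 x.+1 y (leqnSn _) (leqnn _) h1 h2.
have := rS x x.+1 y (x + n) (leqnSn _) h1 h2 (leqnn _); rewrite rt.
by have := r1 x; have := r0 x.+1; have := coloop x xc; move: l1; clear; lia.
Qed.
End LoopColoop.

(** * Interval ranks of an ordered matroid *)

Section NoncrossingPositroid.
Variables (T : finType) (M : matroid T).
Local Notation r := (rank M).
Local Notation E := (ground M).
Local Notation n := #|ground M|.

(** Replaces an injective order by a numbering of [E] by [0, ..., n - 1], as the cyclic windows
    require. *)
Definition position (p : T -> nat) (x : T) : nat := #|[set y in E | p y < p x]|.

Lemma position_ltE p x y : x \in E -> (position p x < position p y) = (p x < p y).
Proof.
move=> xE; have [lt|le] := ltnP (p x) (p y).
  apply: proper_card; apply/properP; split.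
    by apply/subsetP => z; rewrite !inE => /andP[-> /ltn_trans]; apply.
  by exists x; rewrite !inE xE ?lt // ltnn.
apply/negbTE; rewrite -leqNgt; apply: subset_leq_card.
by apply/subsetP => z; rewrite !inE => /andP[-> /leq_trans]; apply.
Qed.

Lemma position_lt p x : x \in E -> position p x < n.
Proof.
move=> xE; apply: proper_card; apply/properP; split.
  by apply/subsetP => z; rewrite inE => /andP[].
by exists x; rewrite // inE ltnn andbF.
Qed.

Lemma position_inj p : {in E &, injective p} -> {in E &, injective (position p)}.
Proof.
move=> pI x y xE yE e; apply: pI => //.
by have := position_ltE p y xE; have := position_ltE p x yE; rewrite e ltnn; case: ltngtP.
Qed.

Lemma noncrossing_position p : noncrossing M p -> noncrossing M (position p).
Proof.
move=> nc S a b c d eS bab bad bcb dep.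
have memE x (X : {set T}) : isbase M (x |: X) -> x \in E.
  by case/andP => /indep_ground/subsetP h _; apply: h; rewrite setU11.
have aE := memE _ _ bab; have cE := memE _ _ bcb.
have bE : b \in E by apply: (memE _ (a |: S)); rewrite setUCA.
have dE : d \in E by apply: (memE _ (a |: S)); rewrite setUCA.
by have := nc S a b c d eS bab bad bcb dep; rewrite /between !position_ltE.
Qed.

Variable p : T -> nat.
Hypothesis p_inj : {in E &, injective p}.
Hypothesis p_lt : {in E, forall x, p x < n}.

Lemma mem_cintP i j x :
  reflect (x \in E /\ exists2 k, i <= k < j & p x = k %% n) (x \in cint M p i j).
Proof.
rewrite inE; apply: (iffP andP) => [[xE /hasP[k]]|[xE [k kij e]]].
  by rewrite mem_index_iota => kij /eqP e; split=> //; exists k.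
by split=> //; apply/hasP; exists k; rewrite ?mem_index_iota ?e.
Qed.

Lemma cintS i j k l : k <= i -> j <= l -> cint M p i j \subset cint M p k l.
Proof.
move=> ki jl; apply/subsetP => x /mem_cintP[xE [m mij e]]; apply/mem_cintP.
by split=> //; exists m => //; move: ki jl mij; clear; lia.
Qed.

Lemma cint_rank : cyclic_rank n (r E) (fun i j => r (cint M p i j)).
Proof.
split.
- move=> a; have -> : cint M p a a = set0; last exact: rank0.
  by apply/setP => x; rewrite in_set0; apply/mem_cintP => -[_ [k]]; clear; lia.
- move=> a; apply: leq_trans (rank_le_card _ _) _; apply/card_le1_eqP => x y.
  move=> /mem_cintP[xE [k ka ex]] /mem_cintP[yE [l la ey]]; apply: p_inj => //.
  by rewrite ex ey; congr (_ %% _); move: ka la; clear; lia.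
- move=> a; congr (r _); apply/setP => x; apply/mem_cintP/idP => [[]//|xE].
  split=> //; have lt := p_lt xE; have n0 : 0 < n by apply: leq_ltn_trans lt.
  have [le|gt] := leqP (a %% n) (p x).
    exists (a %/ n * n + p x); last by rewrite modnMDl modn_small.
    have := divn_eq a n; have := ltn_pmod a n0; move: lt le; clear; lia.
  exists (a %/ n * n + p x + n); last by rewrite modnDr modnMDl modn_small.
  have := divn_eq a n; have := ltn_pmod a n0; move: lt gt; clear; lia.
- move=> a b; congr (r _); apply/setP => x; apply/mem_cintP/mem_cintP => -[xE [k kab e]]; split=> //.
    exists (k - n); first by move: kab; clear; lia.
    by rewrite e -{1}(@subnK n k) ?modnDr //; move: kab; clear; lia.
  by exists (k + n); rewrite ?modnDr //; move: kab; clear; lia.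
- by move=> a b _; apply: rankS; apply: cintS.
- by move=> a b _; apply: rankS; apply: cintS.
move=> a b c d ab bc cd _.
have := rank_submod M (cint M p a c) (cint M p b d).
have : r (cint M p b c) <= r (cint M p a c :&: cint M p b d).
  by apply: rankS; rewrite subsetI !cintS.
have : r (cint M p a d) <= r (cint M p a c :|: cint M p b d).
  apply: rankS; apply/subsetP => x /mem_cintP[xE [k kad e]]; rewrite in_setU.
  have [kc|ck] := ltnP k c; apply/orP; [left|right]; apply/mem_cintP; split=> //; exists k => //.
    by move: kad kc; clear; lia.
  by move: kad ck bc; clear; lia.
by clear; lia.
Qed.

Lemma card_cap_cint (B : {set T}) (chi : nat -> bool) a b :
  {in E, forall x, (x \in B) = chi (p x)} -> (forall k, k < n -> exists2 x, x \in E & p x = k) ->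
  a <= b <= a + n -> #|B :&: cint M p a b| = cyclic_count n chi a b.
Proof.
move=> Bchi surj /andP[]; elim: b => [|b IHb].
  rewrite leqn0 => /eqP -> _; rewrite countnn; apply/eqP; rewrite cards_eq0.
  by apply/eqP/setP => x; rewrite !inE /= !andbF.
rewrite leq_eqVlt => /orP[/eqP <- _|].
  rewrite countnn; apply/eqP; rewrite cards_eq0 -subset0; apply/subsetP => x.
  by rewrite inE => /andP[_ /mem_cintP[_ [k]]]; clear; lia.
rewrite ltnS => ab ba; rewrite countSr // -IHb ?(ltnW ba) //.
have n0 : 0 < n by move: ab ba; clear; lia.
have [x xE px] := surj _ (ltn_pmod b n0).
have ec : cint M p a b.+1 = x |: cint M p a b.
  apply/setP => y; rewrite in_setU1; apply/mem_cintP/orP => [[yE [k kab e]]|[/eqP ->|/mem_cintP[yE [k kab e]]]].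
  - have [kb|nkb] := eqVneq k b; first by left; apply/eqP/p_inj; rewrite // e px kb.
    by right; apply/mem_cintP; split=> //; exists k => //; move: kab nkb; clear; lia.
  - by split=> //; exists b; rewrite // ab ltnSn.
  by split=> //; exists k => //; move: kab; clear; lia.
have nx : x \notin cint M p a b.
  apply/mem_cintP => -[_ [k kab]]; rewrite px => /eqP; rewrite eq_sym => /eqP e.
  have /eqP : k + (b - k) = k + 0 %[mod n].
    by rewrite addn0 subnKC ?e //; move: kab; clear; lia.
  rewrite eqn_modDl mod0n modn_small; move: kab ba; clear; lia.
by rewrite ec setIC cardU1I // -px -Bchi // addnC setIC.
Qed.

End NoncrossingPositroid.

(** * Nonnegative matrices *)

Local Open Scope ring_scope.

Section Realization.
Variable F : realFieldType.

Definition chi_of r n (f : 'I_r -> 'I_n) (k : nat) : bool := [exists i, f i == k :> nat].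

Lemma chi_of_image r n (f : 'I_r -> 'I_n) i : chi_of f (f i).
Proof. by apply/existsP; exists i. Qed.

Lemma chi_ofP r n (f : 'I_r -> 'I_n) (k : 'I_n) :
  reflect (exists i, f i = k) (chi_of f k).
Proof.
apply: (iffP existsP) => [[i /eqP/val_inj e]|[i <-]]; first by exists i.
by exists i.
Qed.

Lemma eq_bounded_by n rho chi1 chi2 : chi1 =1 chi2 ->
  bounded_by n rho chi1 <-> bounded_by n rho chi2.
Proof.
move=> e; have ec a b : cyclic_count n chi1 a b = cyclic_count n chi2 a b.
  by apply: eq_bigr => k _; rewrite e.
by split=> h a b /h; rewrite ec.
Qed.

Lemma increasing_inj r n (f : 'I_r -> 'I_n) : {homo f : i j / (i < j)%N} -> injective f.
Proof.
move=> hf i j e; apply/val_inj; case: (ltngtP i j) => // /hf; rewrite e ltnn //.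
Qed.

Lemma count_chi_of r n (f : 'I_r -> 'I_n) : injective f ->
  cyclic_count n (chi_of f) 0 n = r.
Proof.
move=> fI; rewrite /cyclic_count big_mkord.
rewrite (eq_bigr (fun k : 'I_n => nat_of_bool (k \in codom f))) => [|k _].
  by rewrite -big_mkcond /= sum1_card card_codom // card_ord.
rewrite modn_small //; congr nat_of_bool; apply/chi_ofP/codomP => -[i e]; by exists i.
Qed.

Definition realizes r n (rho : nat -> nat -> nat) (A : 'M[F]_(r, n)) : Prop :=
  forall f : 'I_r -> 'I_n, {homo f : i j / (i < j)%N} ->
    0 <= \det (colsub f A) /\
    (\det (colsub f A) != 0 <-> bounded_by n rho (chi_of f)).

(** By multilinearity a minor through column [i + 1] becomes a sum of two old minors. If column [i]
    is also chosen the second vanishes; otherwise, [i] and [i + 1] being adjacent, the traded choice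
    is still increasing, so both terms are nonnegative and cannot cancel. *)
Lemma realize_bridge r n i l rho : cyclic_rank n r rho -> (i.+1 < n)%N ->
  (forall a, 0 < rho a a.+1)%N -> (forall a, rho a.+1 (a + n)%N = r) ->
  (forall a, at_pos n i a -> bridge_drop n i rho a (a + l)%N) ->
  (exists A : 'M_(r, n), realizes (unbridge n i rho) A) ->
  exists A : 'M_(r, n), realizes rho A.
Proof.
move=> rhoP lti nl nc drop [A' hA'].
pose i0 := Ordinal (ltnW lti); pose i1 := Ordinal lti.
exists (\matrix_(a, b) (A' a b + (b == i1)%:R * A' a i0)) => f hf.
set A := (\matrix_(a, b) _).
have fI := increasing_inj hf.
have hbd := bounded_unbridge rhoP lti nl nc (chi_of f) drop.
have [dge0 dbd] := hA' f hf.
have [/chi_ofP[k fk]|nk] := boolP (chi_of f i1); last first.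
  have -> : colsub f A = colsub f A'.
    apply/matrixP => a b; rewrite !mxE; case: eqP => [e|_]; last by rewrite mul0r addr0.
    by case/negP: nk; apply/chi_ofP; exists b.
  split=> //; split=> [/dbd h|/hbd [/dbd //|[h]]]; first by apply/hbd; left.
  by case/negP: nk.
pose f' j := if j == k then i0 else f j.
have edet : \det (colsub f A) = \det (colsub f A') + \det (colsub f' A').
  rewrite -[in LHS]det_tr -(det_tr (colsub f A')) -(det_tr (colsub f' A')).
  rewrite (@determinant_multilinear _ _ _ (colsub f A')^T (colsub f' A')^T k 1 1) ?mul1r //.
  - by apply/rowP => a; rewrite !mxE /f' fk !eqxx !mul1r.
  - apply/matrixP => a b; rewrite !mxE -fk (inj_eq fI) eq_sym (negbTE (neq_lift _ _)).
    by rewrite mul0r addr0.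
  apply/matrixP => a b; rewrite !mxE -fk (inj_eq fI) /f' eq_sym (negbTE (neq_lift _ _)).
  by rewrite mul0r addr0.
have [/chi_ofP[j fj]|nj] := boolP (chi_of f i0).
  have njk : j != k.
    by apply/eqP => e; move: fj; rewrite e fk => /(congr1 val)/= /esym/n_Sn.
  have d0 : \det (colsub f' A') = 0.
    rewrite -det_tr; apply: (determinant_alternate njk) => a.
    by rewrite !mxE /f' eqxx (negbTE njk) fj.
  rewrite edet d0 addr0; split=> //.
  split=> [/dbd h|/hbd [/dbd //|[_ /negP[]]]]; first by apply/hbd; left.
  by rewrite -[i]/(val i0) -fj chi_of_image.
have hf' : {homo f' : a b / (a < b)%N}.
  move=> a b ab; rewrite /f'; case: eqP => [ea|nea]; case: eqP => [eb|neb].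
  - by move: ab; rewrite ea eb ltnn.
  - have := hf a b ab; rewrite ea fk /=; exact: ltnW.
  - have := hf a b ab; rewrite eb fk /= ltnS leq_eqVlt => /orP[e|//].
    by case/negP: nj; apply/existsP; exists a.
  exact: hf.
have [d'ge0 d'bd] := hA' f' hf'.
rewrite edet; split; first exact: addr_ge0.
have echi : chi_of f' =1 swap_pos i (chi_of f).
  move=> x; rewrite /swap_pos; have [->|nx] := eqVneq x i.
    by apply/existsP; exists k; rewrite /f' eqxx.
  have [->|nx1] := eqVneq x i.+1.
    apply/existsP => -[j]; rewrite /f'; case: (j =P k) => [_|njk /eqP e].
      by rewrite ltn_eqF /=.
    by apply: njk; apply: fI; rewrite fk; apply: val_inj.
  apply/existsP/existsP => -[j e]; exists j; move: e; rewrite /f'; case: (j =P k) => //.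
    by move=> _; rewrite /= eq_sym (negbTE nx).
  by move=> ->; rewrite fk /= eq_sym (negbTE nx1).
rewrite paddr_eq0 // negb_and; split.
  case/orP => [/dbd h|/d'bd h]; apply/hbd; first by left.
  right; split=> //; last by apply/(eq_bounded_by _ _ echi).
  by rewrite -[i.+1]/(val i1) -fk chi_of_image.
case/hbd => [/dbd -> //|[_ _ h]]; apply/orP; right; apply/d'bd.
by apply/(eq_bounded_by _ _ echi).
Qed.

Lemma lift_lt n (c : 'I_n.+1) (a b : 'I_n) : (lift c a < lift c b)%N = (a < b)%N.
Proof. by rewrite /= /bump; case: leqP; case: leqP; clear; lia. Qed.

Lemma realize_loop r m (c : 'I_m.+1) rho : cyclic_rank m.+1 r rho -> (0 < m)%N ->
  rho c c.+1 = 0%N ->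
  (exists A : 'M_(r, m), realizes (delete_pos m c false rho) A) ->
  exists A : 'M_(r, m.+1), realizes rho A.
Proof.
move=> rhoP m0 lc [A' hA'].
have [hr hl] := loop_deletable rhoP (ltn_ord c) lc.
exists (\matrix_(a, b) if unlift c b is Some k then A' a k else 0) => f hf.
have fI := increasing_inj hf.
have hbd := bounded_delete rhoP m0 (ltn_ord c) hr hl (count_chi_of fI).
have [/chi_ofP[k fk]|nk] := boolP (chi_of f c).
  rewrite (expand_det_col _ k) big1 => [|a _]; last by rewrite !mxE fk unlift_none mul0r.
  split=> //; rewrite eqxx; split=> // /hbd [].
  by rewrite -fk chi_of_image.
have /fin_all_exists[g fg] : forall j, exists k, f j = lift c k.
  move=> j; case: (unliftP c (f j)) => [k ->|e]; first by exists k.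
  by case/negP: nk; apply/chi_ofP; exists j.
have hg : {homo g : a b / (a < b)%N}.
  by move=> a b /hf; rewrite !fg lift_lt.
have [dge0 dbd] := hA' g hg.
set A := (\matrix_(a, b) _).
have -> : colsub f A = colsub g A'.
  by apply/matrixP => a b; rewrite !mxE fg liftK.
split=> //.
have echi : chi_of f \o bump c =1 chi_of g.
  by move=> x; apply: eq_existsb => j; rewrite fg /= (inj_eq (can_inj (bumpK c))).
split=> [/dbd h|/hbd[_ h]].
  apply/hbd; split; first exact: negbTE.
  by apply/(eq_bounded_by _ _ echi).
by apply/dbd/(eq_bounded_by _ _ echi).
Qed.

Lemma sum_ord_lt n k : (k <= n)%N -> (\sum_(j < n) (j < k)%N = k)%N.
Proof.
move=> kn; rewrite -(big_mkord xpredT (fun j => nat_of_bool (j < k)%N)) -big_mkcond /=.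
by rewrite -(big_nat_widen _ _ _ xpredT) // sum_nat_const_nat subn0 muln1.
Qed.

(** A new first row singles out column [c]. The signs on the columns before [c] cancel the cofactor
    sign, whose exponent is the number of chosen columns before [c]. *)
Lemma realize_coloop r m (c : 'I_m.+1) rho : cyclic_rank m.+1 r.+1 rho -> (0 < m)%N ->
  (rho c.+1 (c + m.+1) < r.+1)%N ->
  (exists A : 'M_(r, m), realizes (delete_pos m c true rho) A) ->
  exists A : 'M_(r.+1, m.+1), realizes rho A.
Proof.
move=> rhoP m0 lc [A' hA'].
have [hr hl] := coloop_deletable rhoP lc.
exists (\matrix_(a, b) if unlift ord0 a is Some a' then
  (if unlift c b is Some k then (-1) ^+ (b < c)%N * A' a' k else 0) else (b == c)%:R).
set A := (\matrix_(a, b) _) => f hf.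
have fI := increasing_inj hf.
have hbd := bounded_delete rhoP m0 (ltn_ord c) hr hl (count_chi_of fI).
have A0 j : colsub f A ord0 j = (f j == c)%:R by rewrite !mxE unlift_none.
have [/chi_ofP[k fk]|nk] := boolP (chi_of f c); last first.
  rewrite (expand_det_row _ ord0) big1 => [|j _]; last first.
    rewrite A0; case: eqP => [e|_]; last by rewrite mul0r.
    by case/negP: nk; apply/chi_ofP; exists j.
  by split=> //; rewrite eqxx; split=> // /hbd [h]; case/negP: nk.
have /fin_all_exists[g fg] : forall j, exists x, f (lift k j) = lift c x.
  move=> j; case: (unliftP c (f (lift k j))) => [x ->|]; first by exists x.
  by rewrite -fk => /fI/eqP; rewrite eq_sym (negbTE (neq_lift _ _)).
have hg : {homo g : a b / (a < b)%N}.
  move=> a b ab; rewrite -(lift_lt c) -!fg; apply: hf.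
  by rewrite lift_lt.
have [dge0 dbd] := hA' g hg.
have -> : \det (colsub f A) = \det (colsub g A').
  rewrite (expand_det_row _ ord0) (bigD1 k) //= big1 => [|j njk]; last first.
    by rewrite A0 -fk (inj_eq fI) (negbTE njk) mul0r.
  rewrite A0 fk eqxx mul1r addr0 /cofactor add0n.
  have -> : row' ord0 (col' k (colsub f A)) =
      colsub g A' *m diag_mx (\row_j (-1) ^+ (j < k)%N).
    apply/matrixP => a b; rewrite mul_mx_diag !mxE liftK fg liftK -fg mulrC; congr (_ * _ ^+ _).
    congr nat_of_bool; rewrite -fk.
    have -> : (f (lift k b) < f k)%N = (lift k b < k)%N.
      apply/idP/idP => [|/hf //]; apply: contraTT; rewrite -!leqNgt leq_eqVlt.
      by case/orP => [/eqP/val_inj <- //|/hf/ltnW].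
    by rewrite /= /bump; case: leqP; clear; lia.
  rewrite det_mulmx det_diag (eq_bigr (fun j : 'I_r => (-1) ^+ (j < k)%N)) => [|j _]; last by rewrite mxE.
  rewrite prodrXr sum_ord_lt; last by rewrite -ltnS.
  by rewrite mulrC -mulrA -expr2 sqrr_sign mulr1.
split=> //.
have echi : chi_of f \o bump c =1 chi_of g.
  move=> x; apply/existsP/existsP => -[j /eqP e].
    case: (unliftP k j) e => [j' -> e|-> e].
      by exists j'; apply/eqP/(can_inj (bumpK c)); rewrite -e fg.
    by move: e; rewrite fk => /eqP; rewrite (negbTE (neq_bump _ _)).
  by exists (lift k j); rewrite fg /= e.
split=> [/dbd h|/hbd[_ h]].
  apply/hbd; split; first by rewrite -fk chi_of_image.
  by apply/(eq_bounded_by _ _ echi).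
by apply/dbd/(eq_bounded_by _ _ echi).
Qed.

(** Induction on [n] and, for fixed [n], on [rank_sum]: a loop or coloop lowers [n], and without
    either a bridge can be undone. *)
Theorem cyclic_rank_realizable n r rho : cyclic_rank n r rho ->
  exists A : 'M_(r, n), realizes rho A.
Proof.
elim: n r rho => [|m IHm] r rho rhoP.
  have r0 : r = 0%N by rewrite -(crank_total rhoP 0) (crank0 rhoP).
  subst r; exists 0 => f _; rewrite det_mx00 oner_eq0 ler01; split=> //; split=> // _.
  move=> a b; rewrite addn0 -eqn_leq => /eqP <-.
  by rewrite countnn.
have [k] := ubnP (rank_sum m.+1 rho); elim: k rho rhoP => // k IHk rho rhoP ltk.
have [m0|m_gt0] := posnP m.
  subst m; have r1 : (r <= 1)%N by rewrite -(crank_total rhoP 0) add0n (crank1 rhoP).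
  (* On one position the rank is 0 or 1, and the all-ones matrix serves both. *)
  exists (const_mx 1) => f _.
  have -> : \det (colsub f (const_mx 1 : 'M[F]_(r, 1))) = 1.
    case: r r1 f {rhoP IHk} => [|[|//]] _ f; first by rewrite det_mx00.
    by rewrite det_mx11 !mxE.
  rewrite oner_eq0 ler01; split=> //; split=> // _ a b.
  rewrite addn1 => /andP[ab]; rewrite leq_eqVlt => /orP[/eqP ->|]; last first.
    by rewrite ltnS => ba; rewrite (_ : b = a) ?countnn //; apply/eqP; rewrite eqn_leq ba.
  rewrite countSr // countnn -(addn1 a) (crank_total rhoP) modn1 add0n.
  have [/existsP[i _]|//] := boolP (chi_of f 0).
  by apply: leq_ltn_trans (ltn_ord i).
have [/existsP[c /eqP lc]|/existsPn nl] := boolP [exists c : 'I_m.+1, rho c c.+1 == 0%N].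
  apply: (realize_loop rhoP m_gt0 lc); apply: IHm.
  have [hr hl] := loop_deletable rhoP (ltn_ord c) lc.
  have := delete_rank rhoP m_gt0 (ltn_ord c) hr hl.
  by rewrite subn0.
have [/existsP[c lc]|/existsPn nc] :=
    boolP [exists c : 'I_m.+1, (rho c.+1 (c + m.+1) < r)%N].
  case: r rhoP lc {IHk ltk} => [//|r] rhoP lc.
  apply: (realize_coloop rhoP m_gt0 lc); apply: IHm.
  have [hr hl] := coloop_deletable rhoP lc.
  have := delete_rank rhoP m_gt0 (ltn_ord c) hr hl.
  by rewrite subn1.
have nl' a : (0 < rho a a.+1)%N.
  have := nl (Ordinal (ltn_pmod a (ltn0Sn m))); rewrite -lt0n /=.
  have := crank_congr rhoP 1 (modn_mod a m.+1); rewrite !addn1 => -> //.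
have nc' a : rho a.+1 (a + m.+1)%N = r.
  apply/eqP; rewrite eqn_leq -{1}(crank_total rhoP a) (crankSl rhoP) ?leqnn ?andbT /=; last first.
    by rewrite addnS ltnS leq_addr.
  have := nc (Ordinal (ltn_pmod a (ltn0Sn m))); rewrite -leqNgt /=.
  have e : (a %% m.+1).+1 = a.+1 %[mod m.+1] by rewrite -addn1 modnDml addn1.
  by have := crank_congr rhoP m e; rewrite !addSnnS => ->.
have [i [l [lti ltl drop]]] := exists_bridge rhoP nl' nc' (ltn_ord (Ordinal m_gt0)).
apply: (realize_bridge rhoP lti nl' nc' drop); apply: IHk.
  exact: unbridge_rank.
by have := rank_sum_unbridge lti ltl drop; move: ltk; clear; lia.
Qed.
End Realization.

(** * Free families of columns and determinants *)

Section DetFree.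
Variables (F : fieldType).

Lemma free_det r (B : 'M[F]_r) :
  free [seq col j B | j <- enum 'I_r] = (\det B != 0).
Proof.
set X := [seq _ | _ <- _].
have sX : size X == r by rewrite size_map size_enum_ord.
have nthX (i : 'I_r) : X`_i = col i B.
  by rewrite (nth_map i) ?size_enum_ord // nth_ord_enum.
have sumX (k : 'I_r -> F) : \sum_(i < r) k i *: X`_i = ((\row_i k i) *m B^T)^T.
  rewrite trmx_mul trmxK; apply/colP => a; rewrite summxE !mxE.
  by apply: eq_bigr => i _; rewrite nthX !mxE mulrC.
rewrite -det_tr; apply/idP/idP => [fX|dB].
  apply/det0P => -[v nv vB]; case/eqP: nv; apply/rowP => i; rewrite mxE.
  have /freeP h : free (Tuple sX) := fX.
  apply: (h (fun i => v 0 i)); rewrite /= sumX.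
  have -> : \row_i0 v 0 i0 = v by apply/rowP => j; rewrite mxE.
  by rewrite vB trmx0.
suff /freeP : forall k : 'I_r -> F, \sum_(i < r) k i *: (Tuple sX)`_i = 0 ->
  forall i, k i = 0 by [].
move=> k; rewrite /= sumX => /(congr1 trmx); rewrite trmxK trmx0 => e i.
apply/eqP; apply: contraNT dB => nk; apply/det0P; exists (\row_i k i) => //.
by apply: contra nk => /eqP/rowP/(_ i); rewrite !mxE => ->.
Qed.

Lemma perm_enum_imset (I J : finType) (f : I -> J) : injective f ->
  perm_eq (enum (f @: [set: I])) [seq f i | i <- enum I].
Proof.
move=> fI; apply: uniq_perm => [||x]; first exact: enum_uniq.
  by rewrite (map_inj_uniq fI); apply: enum_uniq.
rewrite mem_enum; apply/imsetP/mapP => -[i _ ->]; by exists i; rewrite ?mem_enum.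
Qed.

Lemma free_colsub r n (A : 'M[F]_(r, n)) (f : 'I_r -> 'I_n) : injective f ->
  free [seq col j A | j <- enum (f @: [set: 'I_r])] = (\det (colsub f A) != 0).
Proof.
move=> fI; rewrite -free_det (perm_free (perm_map _ (perm_enum_imset fI))).
by rewrite -map_comp; congr free; apply: eq_map => j; apply/colP => a; rewrite !mxE.
Qed.

Lemma free_colS r n (A : 'M[F]_(r, n)) (J K : {set 'I_n}) : J \subset K ->
  free [seq col j A | j <- enum K] -> free [seq col j A | j <- enum J].
Proof.
move=> JK; have e : perm_eq (enum K) (enum J ++ enum (K :\: J)).
  apply: uniq_perm; rewrite ?enum_uniq //.
    rewrite cat_uniq !enum_uniq andbT /=; apply/hasPn => x.
    by rewrite !mem_enum inE => /andP[].
  move=> x; rewrite mem_cat !mem_enum inE; case xJ: (x \in J) => //=.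
  by rewrite (subsetP JK).
by rewrite (perm_free (perm_map _ e)) map_cat => /catl_free.
Qed.

Lemma free_colU1 r n (A : 'M[F]_(r, n)) (J : {set 'I_n}) j : j \notin J ->
  free [seq col k A | k <- enum (j |: J)] =
  (col j A \notin <<[seq col k A | k <- enum J]>>%VS) && free [seq col k A | k <- enum J].
Proof.
move=> jJ; rewrite -free_cons -[_ :: _]/[seq col k A | k <- j :: enum J].
apply/perm_free/perm_map/uniq_perm; rewrite /= ?enum_uniq ?mem_enum ?jJ //.
by move=> x; rewrite in_cons !mem_enum in_setU1.
Qed.

Lemma free_col_card r n (A : 'M[F]_(r, n)) (J : {set 'I_n}) :
  free [seq col j A | j <- enum J] -> (#|J| <= r)%N.
Proof.
rewrite /free => /eqP; rewrite size_map -cardE => <-.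
by have := dimvS (subvf <<[seq col j A | j <- enum J]>>%VS); rewrite dimvf /dim /= muln1.
Qed.

(** The matrix counterpart of [indep_extend]: a maximal free set of columns containing [J] spans the
    columns of [K], so it has [r] elements. *)
Lemma free_col_extend r n (A : 'M[F]_(r, n)) (J K : {set 'I_n}) :
  free [seq col j A | j <- enum J] -> free [seq col j A | j <- enum K] -> #|K| = r ->
  exists L : {set 'I_n}, [/\ J \subset L, #|L| = r & free [seq col j A | j <- enum L]].
Proof.
move=> fJ fK cK.
have [L /maxsetP[fL maxL] JL] :=
  @maxset_exists _ [pred L : {set 'I_n} | free [seq col j A | j <- enum L]] J fJ.
exists L; split=> //; apply/eqP; rewrite eqn_leq (free_col_card fL) leqNgt.
apply/negP => ltL; have : ~~ (<<[seq col j A | j <- enum K]>> <= <<[seq col j A | j <- enum L]>>)%VS.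
  apply/negP => /dimvS; move: fK fL; rewrite /free => /eqP -> /eqP ->.
  by rewrite !size_map -!cardE cK leqNgt ltL.
case/span_subvP => v /mapP[j]; rewrite mem_enum => jK ->; apply/negPn/negP => nj.
have jL : j \notin L.
  by apply: contra nj => jL; apply: memv_span; apply: map_f; rewrite mem_enum.
have /maxL/(_ (subsetUr _ _)) e : j |: L \in [pred L : {set 'I_n} | free [seq col j A | j <- enum L]].
  by rewrite inE /= free_colU1 // nj.
by case/negP: jL; rewrite -e setU11.
Qed.
End DetFree.

Lemma enum_val_lt n (J : {set 'I_n}) (i j : 'I_#|J|) :
  (i < j)%N -> (enum_val i < enum_val j)%N.
Proof.
move=> ij; have [x0 _] : exists x0 : 'I_n, true by exists (enum_val i).
rewrite !(enum_val_nth x0).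
have tr : transitive (relpre (@nat_of_ord n) ltn) by move=> x y z; apply: ltn_trans.
have sJ : sorted (relpre (@nat_of_ord n) ltn) (enum J).
  apply: (sorted_filter tr); rewrite -sorted_map -enumT val_enum_ord.
  exact: iota_ltn_sorted.
by apply: (sorted_ltn_nth tr _ sJ); rewrite ?inE -?cardE.
Qed.

Lemma exists_sorting_perm r n (f : 'I_r -> 'I_n) : injective f ->
  exists s : 'S_r, {homo f \o s : i j / (i < j)%N}.
Proof.
move=> fI; pose J := f @: [set: 'I_r].
have cJ : #|J| = r by rewrite card_imset // cardsT card_ord.
have /fin_all_exists[s hs] : forall i : 'I_r, exists j, f j = enum_val (cast_ord (esym cJ) i).
  move=> i; have /imsetP[j _ ->] := enum_valP (cast_ord (esym cJ) i).
  by exists j.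
have sI : injective s.
  by move=> i j e; have := hs i; rewrite e hs => /enum_val_inj/cast_ord_inj.
exists (perm sI) => i j ij; rewrite /= !permE !hs.
exact: enum_val_lt.
Qed.

(** * Signs of minors with two varying columns *)

Section Signs.
Variable R : realFieldType.

(* Both factors change by the same sign when [f] is permuted, so the sign of   *)
(* an arbitrary minor is read off the Vandermonde determinant of its columns.  *)
Lemma nonneg_minor_Vandermonde r n (A : 'M[R]_(r, n)) (f : 'I_r -> 'I_n) :
  (forall g : 'I_r -> 'I_n, {homo g : i j / (i < j)%N} -> 0 <= \det (colsub g A)) ->
  0 <= \det (colsub f A) *
    \prod_(i < r) \prod_(j < r | (i < j)%N) ((f j : nat)%:R - (f i : nat)%:R).
Proof.
move=> hA; pose V : 'M[R]_(r, n) := Vandermonde r (\row_j (j : nat)%:R).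
have detV (g : 'I_r -> 'I_n) : \prod_(i < r) \prod_(j < r | (i < j)%N) ((g j : nat)%:R - (g i : nat)%:R) =
    \det (colsub g V).
  have -> : colsub g V = Vandermonde r (\row_j (g j : nat)%:R).
    by apply/matrixP => i j; rewrite !mxE.
  by rewrite det_Vandermonde; apply: eq_bigr => i _; apply: eq_bigr => j _; rewrite !mxE.
have [/injectiveP fI|/injectivePn[i [j nij fij]]] := boolP (injectiveb f); last first.
  have -> : \det (colsub f A) = 0; last by rewrite mul0r.
  by rewrite -det_tr; apply: (determinant_alternate nij) => a; rewrite !mxE fij.
have [s hs] := exists_sorting_perm fI.
have perm_det (B : 'M[R]_(r, n)) : \det (colsub (f \o s) B) = \det (colsub f B) * (-1) ^+ s.
  have -> : colsub (f \o s) B = col_perm s (colsub f B).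
    by apply/matrixP => i j; rewrite !mxE.
  by rewrite col_permE det_mulmx det_perm odd_permV.
rewrite detV; have -> : \det (colsub f A) * \det (colsub f V) =
    \det (colsub (f \o s) A) * \det (colsub (f \o s) V).
  by rewrite !perm_det mulrACA -expr2 sqrr_sign mulr1.
rewrite mulr_ge0 ?hA // -detV; apply: prodr_ge0 => i _; apply: prodr_ge0 => j ij.
by rewrite subr_ge0 ler_nat ltnW ?hs.
Qed.

(** The choice is in general not increasing, so the sign of its minor is compared with a Vandermonde
    determinant. *)
Definition pair_cols q n (G : 'I_q -> 'I_n) (x y : 'I_n) (k : 'I_(2 + q)) : 'I_n :=
  match split k with inl k' => if k' == ord0 then x else y | inr k' => G k' end.

Lemma pair_colsl q n (G : 'I_q -> 'I_n) x y (k : 'I_2) :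
  pair_cols G x y (lshift q k) = if k == ord0 then x else y.
Proof. by rewrite /pair_cols (unsplitK (inl k)). Qed.

Lemma pair_colsr q n (G : 'I_q -> 'I_n) x y (k : 'I_q) :
  pair_cols G x y (rshift 2 k) = G k.
Proof. by rewrite /pair_cols (unsplitK (inr k)). Qed.

Lemma det_pair_cols q n (Z : 'M[R]_(2 + q, n)) G x y :
  (forall k l, Z l (G k) = (l == rshift 2 k)%:R) ->
  \det (colsub (pair_cols G x y) Z) =
  Z (lshift q ord0) x * Z (lshift q ord_max) y - Z (lshift q ord_max) x * Z (lshift q ord0) y.
Proof.
move=> hG; set B := colsub _ Z.
rewrite -(submxK B).
have -> : ursubmx B = 0.
  apply/matrixP => i j; rewrite !mxE pair_colsr hG.
  by rewrite eq_lrshift.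
have -> : drsubmx B = 1%:M.
  apply/matrixP => i j; rewrite !mxE pair_colsr hG.
  by rewrite eq_rshift.
rewrite det_lblock det1 mulr1 (expand_det_row _ ord0) !big_ord_recl big_ord0 addr0.
rewrite /cofactor !det_mx11 !mxE !pair_colsl /=.
have -> : lift ord0 0 = ord_max :> 'I_2 by apply: val_inj.
by rewrite !add0n expr0 expr1; ring.
Qed.

(** The Vandermonde product separates: [h] gathers the differences with [G], [kappa] those within
    [G], and only [y - x] couples the two varying columns. *)
Lemma prod_pair_cols q n (G : 'I_q -> 'I_n) : exists (h : 'I_n -> R) (kappa : R),
  forall x y, \prod_(i < 2 + q) \prod_(j < 2 + q | (i < j)%N)
    ((pair_cols G x y j : nat)%:R - (pair_cols G x y i : nat)%:R) =
  ((y : nat)%:R - (x : nat)%:R) * h x * h y * kappa.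
Proof.
exists (fun z => \prod_(k < q) ((G k : nat)%:R - (z : nat)%:R)).
exists (\prod_(i < q) \prod_(j < q | (i < j)%N) ((G j : nat)%:R - (G i : nat)%:R)).
move=> x y.
have inner (i : 'I_(2 + q)) (H : 'I_(2 + q) -> R) : \prod_(j < 2 + q | (i < j)%N) H j =
    (\prod_(j < 2) if (i < lshift q j)%N then H (lshift q j) else 1) *
    (\prod_(j < q) if (i < rshift 2 j)%N then H (rshift 2 j) else 1).
  by rewrite big_mkcond big_split_ord.
rewrite (eq_bigr _ (fun i _ => inner i _)) big_split_ord.
rewrite !big_ord_recl !big_ord0 /=.
rewrite !pair_colsl /=.
have e1 (z : 'I_n) : \prod_(j < q) ((pair_cols G x y (rshift 2 j) : nat)%:R - (z : nat)%:R) =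
    \prod_(k < q) ((G k : nat)%:R - (z : nat)%:R) :> R.
  by apply: eq_bigr => k _; rewrite pair_colsr.
rewrite !e1 [X in _ * X = _](_ : _ = \prod_(i < q) \prod_(j < q | (i < j)%N)
  ((G j : nat)%:R - (G i : nat)%:R)); first by ring.
apply: eq_bigr => i _; rewrite big1 => [|j _]; last first.
  by rewrite ltnNge (leq_trans (ltnW (ltn_ord j))) ?leq_addr.
rewrite mul1r [RHS]big_mkcond; apply: eq_bigr => j _.
by rewrite ltn_add2l !pair_colsr.
Qed.

Lemma between_sign (T : finType) (p : T -> nat) a x c : between p a x c =
  (((p x)%:R - (p a)%:R) * ((p x)%:R - (p c)%:R) < 0 :> R).
Proof.
rewrite /between -!(ltr_nat R); move: (_%:R) (_%:R) (_%:R) => C X A.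
apply/idP/idP => [/orP[]/andP[h1 h2]|]; [nra|nra|apply: contraTT].
rewrite -leNgt negb_or !negb_and -!leNgt => /andP[/orP[h|h]/orP[h'|h']].
- by rewrite mulr_le0 ?subr_le0.
- by rewrite (_ : X = A) ?subrr ?mul0r //; lra.
- by rewrite (_ : X = C) ?subrr ?mulr0 //; lra.
by rewrite mulr_ge0 ?subr_ge0.
Qed.

Lemma same_sign (u v w : R) : 0 < u * v -> 0 < u * w -> (v < 0) = (w < 0).
Proof.
have sgn x : 0 < u * x -> (x < 0) = (u < 0).
  by move=> h; apply/idP/idP => lt; move: h; rewrite ?(nmulr_lgt0 _ lt) ?(nmulr_rgt0 _ lt).
by move=> /sgn -> /sgn ->.
Qed.
End Signs.

(** * Positroids and noncrossing orders *)

Section PositroidNoncrossing.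
Variables (R : realType) (T : finType) (M : matroid T).
Local Notation E := (ground M).
Local Notation n := #|ground M|.

Lemma pair_cols_image q m (G : 'I_q -> 'I_m) x y :
  pair_cols G x y @: [set: 'I_(2 + q)] = x |: (y |: (G @: [set: 'I_q])).
Proof.
apply/setP => z; apply/imsetP/idP => [[i _ ->]|].
  rewrite /pair_cols !inE; case: split => k; last by rewrite imset_f ?orbT.
  by case: (k == ord0); rewrite eqxx ?orbT.
rewrite !inE => /or3P[/eqP->|/eqP->|/imsetP[k _ ->]].
- by exists (lshift q ord0); rewrite ?pair_colsl.
- by exists (lshift q ord_max); rewrite ?pair_colsl.
by exists (rshift 2 k); rewrite ?pair_colsr.
Qed.

Lemma represents_minor r (s : 'I_n -> T) (A : 'M[R]_(r, n)) (f : 'I_r -> 'I_n) :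
  injective s -> represents M s A -> r = rank M E ->
  isbase M (s @: (f @: [set: 'I_r])) = (\det (colsub f A) != 0).
Proof.
move=> sI rep er; rewrite /isbase rep -er (card_imset _ sI).
have [/injectiveP fI|/injectivePn[i [j nij fij]]] := boolP (injectiveb f).
  by rewrite (card_imset _ fI) cardsT card_ord eqxx andbT free_colsub.
have -> : \det (colsub f A) = 0.
  by rewrite -det_tr; apply: (determinant_alternate nij) => a; rewrite !mxE fij.
rewrite eqxx /=; apply/negbTE; rewrite negb_and; apply/orP; right.
apply/negP => /eqP e; have /imset_injP fI : #|f @: [set: 'I_r]| == #|[set: 'I_r]|.
  by rewrite e cardsT card_ord.
by case/eqP: nij; apply: fI.
Qed.

(** All factors depending on one column alone pair up into squares or are common to [b] and [d];
    what is left compares the sign of [(b - a)(b - c)] with that of [(d - a)(d - c)]. *)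
Lemma tnn_noncrossing q (s : 'I_n -> T) (A : 'M[R]_(2 + q, n)) (p : T -> nat)
    (G : 'I_q -> 'I_n) a b c d :
  injective s -> represents M s A -> nonneg_max_minors A -> (2 + q = rank M E)%N ->
  (forall i, p (s i) = i) ->
  let base x y := isbase M (s x |: (s y |: (s @: (G @: [set: 'I_q])))) in
  base a b -> base a d -> base c b -> ~~ base a c ->
  between p (s a) (s b) (s c) = between p (s a) (s d) (s c).
Proof.
move=> sI rep tnn er ps base.
have baseE x y : base x y = (\det (colsub (pair_cols G x y) A) != 0).
  by rewrite -(represents_minor _ sI rep er) pair_cols_image !imsetU1.
rewrite !baseE => hab had hcb; rewrite negbK => /eqP hac.
set P := colsub (pair_cols G a b) A in hab.
have Pu : P \in unitmx by rewrite unitmxE unitfE.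
(* Change of basis making the columns [a], [b] and [G] the standard basis. *)
pose Z := invmx P *m A.
have [D D0 ZE] : exists2 D : R, D != 0 & forall x y,
    \det (colsub (pair_cols G x y) A) = D * \det (colsub (pair_cols G x y) Z).
  exists (\det P) => // x y; rewrite -det_mulmx; congr (\det _); apply/matrixP => i j.
  rewrite mxE -[A in LHS](mulKVmx Pu) !mxE; apply: eq_bigr => k _.
  by rewrite !mxE.
have ZP i j : Z i (pair_cols G a b j) = (i == j)%:R.
  have := congr1 (fun B : 'M[R]_(2 + q) => B i j) (mulVmx Pu); rewrite !mxE => <-.
  by apply: eq_bigr => k _; rewrite !mxE.
have hG k l : Z l (G k) = (l == rshift 2 k)%:R by rewrite -ZP pair_colsr.
have Z0a : Z (lshift q ord0) a = 1 by have := ZP (lshift q ord0) (lshift q ord0); rewrite pair_colsl eqxx.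
have Z1a : Z (lshift q ord_max) a = 0 by have := ZP (lshift q ord_max) (lshift q ord0); rewrite pair_colsl.
have Z0b : Z (lshift q ord0) b = 0 by have := ZP (lshift q ord0) (lshift q ord_max); rewrite pair_colsl.
have Z1b : Z (lshift q ord_max) b = 1 by have := ZP (lshift q ord_max) (lshift q ord_max); rewrite pair_colsl eqxx.
have [h [kappa hk]] := @prod_pair_cols R q n G.
have pos x y := nonneg_minor_Vandermonde (pair_cols G x y) tnn.
have det2 x y := det_pair_cols x y hG.
have prod_neq0 x y : D * \det (colsub (pair_cols G x y) Z) != 0 ->
    (((y : nat)%:R - (x : nat)%:R) * h x * h y * kappa : R) != 0.
  rewrite -ZE => dn; rewrite -hk; apply/prodf_neq0 => i _; apply/prodf_neq0 => j ij.
  rewrite subr_eq0 eqr_nat; apply: contra dn => /eqP/val_inj e; apply/eqP.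
  have nij : i != j by apply: contraTneq ij => ->; rewrite ltnn.
  by rewrite -det_tr; apply: (determinant_alternate nij) => l; rewrite !mxE e.
have posD x y : D * \det (colsub (pair_cols G x y) Z) != 0 ->
    0 < D * \det (colsub (pair_cols G x y) Z) *
      (((y : nat)%:R - (x : nat)%:R) * h x * h y * kappa).
  by move=> dn; rewrite lt_neqAle eq_sym mulf_neq0 ?prod_neq0 //= -ZE -hk pos.
have Dab : D * \det (colsub (pair_cols G a b) Z) != 0 by rewrite -ZE.
move: had hcb hac; rewrite !ZE => had hcb hac.
(* As [a] and [c] are parallel, the minor of [Z] on [c, d] is the product of those on [c, b] and
   [a, d]. *)
have Dcd : D * \det (colsub (pair_cols G c d) Z) != 0.
  move: had hcb hac; rewrite !det2 Z0a Z1a Z0b Z1b.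
  rewrite !(mul0r, mulr0, mul1r, mulr1, subr0) => had hcb /eqP.
  rewrite mulf_eq0 (negbTE D0) => /eqP -> ; rewrite mul0r subr0.
  by move: had hcb; rewrite !mulf_eq0 (negbTE D0) /= => /negbTE -> /negbTE ->.
have := posD _ _ Dab; have := posD _ _ had; have := posD _ _ hcb; have := posD _ _ Dcd.
move: hac; rewrite !det2 Z0a Z1a Z0b Z1b.
rewrite !(mul0r, mulr0, mul1r, mulr1, subr0) => /eqP; rewrite mulf_eq0 (negbTE D0) => /eqP ->.
rewrite mul0r subr0; move: (Z _ c) (Z _ d) => cz dz I4 I2 I3 I1.
have sq x y : 0 < x ^+ 2 * y -> 0 < y :> R.
  by apply: contraTT; rewrite -!leNgt => h0; rewrite mulr_ge0_le0 ?sqr_ge0.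
rewrite !(between_sign R) !ps; apply: (@same_sign R (cz * h a * h c)).
  (* The quantities for [a, b] and [c, b] multiply to this square times [cz * h a * h c] times the
     difference product of [b]; those for [a, d] and [c, d] do the same for [d]. *)
  apply: (sq (D * kappa * h b)).
  by have := mulr_gt0 I1 I2; congr (0 < _); ring.
apply: (sq (D * kappa * h d * dz)).
by have := mulr_gt0 I3 I4; congr (0 < _); ring.
Qed.

Lemma positroid_noncrossing : positroid R M ->
  exists2 p : T -> nat, {in E &, injective p} & noncrossing M p.
Proof.
case=> s [A [sI sE rep tnn]].
pose p x : nat := if [pick i | s i == x] is Some i then i else 0%N.
have ps i : p (s i) = i.
  by rewrite /p; case: pickP => [j /eqP/sI -> //|/(_ i)]; rewrite eqxx.
have surj x : x \in E -> exists i, x = s i.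
  move=> xE; have /imsetP[i _ ->] : x \in s @: [set: 'I_n] by rewrite sE.
  by exists i.
exists p => [x y /surj[i ->] /surj[j ->]|]; first by rewrite !ps => /val_inj ->.
move=> S a b c d eS bab bad bcb dep.
have memE x (X : {set T}) : isbase M (x |: X) -> x \in E.
  by case/andP => /indep_ground/subsetP h _; apply: h; rewrite setU11.
have [ia ea] := surj a (memE _ _ bab); have [ic ec] := surj c (memE _ _ bcb).
have [ib eb] : exists i, b = s i by apply/surj/(memE _ (a |: S)); rewrite setUCA.
have [id ed] : exists i, d = s i by apply/surj/(memE _ (a |: S)); rewrite setUCA.
subst a b c d.
have SE : S \subset E.
  case/andP: bab => /indep_ground h _; apply: subset_trans h.
  exact: subset_trans (subsetUr _ _) (subsetUr _ _).
pose J := s @^-1: S.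
have eJ : s @: J = S.
  apply/setP => x; apply/imsetP/idP => [[i + ->]|xS]; first by rewrite inE.
  by have [i e] := surj x (subsetP SE x xS); exists i; rewrite // inE -e.
pose G (k : 'I_#|J|) : 'I_n := enum_val k.
have eG : G @: [set: 'I_#|J|] = J.
  apply/setP => i; apply/imsetP/idP => [[k _ ->]|iJ]; first exact: enum_valP.
  by exists (enum_rank_in iJ i); rewrite ?inE // /G enum_rankK_in.
have er : (2 + #|J|)%N = rank M E by rewrite -eS -eJ (card_imset _ sI).
have [B [repB tnnB]] : exists B : 'M[R]_(2 + #|J|, n), represents M s B /\ nonneg_max_minors B.
  by move: (A) rep tnn; rewrite -er => B repB tnnB; exists B.
apply: (tnn_noncrossing (G := G) sI repB tnnB er ps); rewrite eG eJ //.
by apply: contra dep => /andP[].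
Qed.
End PositroidNoncrossing.

(** The interval ranks are realized by a matrix whose nonzero minors are the bases of [M], by
    [indep_of_cint]. Smaller independent sets follow, since on both sides they are the subsets of
    bases. *)
Lemma noncrossing_positroid (R : realType) (T : finType) (M : matroid T) (p : T -> nat) :
  {in ground M &, injective p} -> noncrossing M p -> positroid R M.
Proof.
move=> pI0 nc0; have pI := position_inj pI0; have nc := noncrossing_position nc0.
have p_lt x : x \in ground M -> (position M p x < #|ground M|)%N := @position_lt _ M p x.
move: (position M p) pI nc p_lt => {p pI0 nc0} p p_inj nc p_lt.
have qlt (i : 'I_#|ground M|) : (p (enum_val i) < #|ground M|)%N by apply: p_lt; apply: enum_valP.
have q_inj : injective (fun i => Ordinal (qlt i)).
  by move=> i j /(congr1 val)/= /p_inj e; apply: enum_val_inj; apply: e; apply: enum_valP.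
pose s i := enum_val (invF q_inj i).
have ps i : p (s i) = i by have /(congr1 val) := f_invF q_inj i.
have sE i : s i \in ground M by apply: enum_valP.
have s_inj : injective s by move=> i j e; apply: val_inj; rewrite /= -!ps e.
have sp x (xE : x \in ground M) : s (Ordinal (p_lt x xE)) = x.
  by apply: p_inj => //; rewrite ps.
have [A hA] := cyclic_rank_realizable R (cint_rank p_inj p_lt).
have sT : s @: [set: 'I__] = ground M.
  apply/setP => x; apply/imsetP/idP => [[i _ ->]//|xE].
  by exists (Ordinal (p_lt x xE)); rewrite ?sp.
have surj k : (k < #|ground M|)%N -> exists2 x, x \in ground M & p x = k.
  by move=> lt; exists (s (Ordinal lt)); rewrite ?ps.
have indep_det (f : 'I_(rank M (ground M)) -> 'I_#|ground M|) :
    {homo f : i j / (i < j)%N} ->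
    (s @: (f @: [set: 'I__]) \in indep M) = (\det (colsub f A) != 0).
  move=> hf; have [_ hbd] := hA f hf; have f_inj := increasing_inj hf.
  pose B := s @: (f @: [set: 'I__]).
  have BE : B \subset ground M by apply/subsetP => x /imsetP[i _ ->].
  have cB : #|B| = rank M (ground M).
    by rewrite (card_imset _ s_inj) (card_imset _ f_inj) cardsT card_ord.
  have Bchi : {in ground M, forall x, (x \in B) = chi_of f (p x)}.
    move=> x xE; rewrite -(sp x xE) ps (mem_imset _ _ s_inj).
    by apply/imsetP/chi_ofP => [[i _ ->]|[i <-]]; exists i.
  have cnt a b := @card_cap_cint _ M p p_inj B (chi_of f) a b Bchi surj.
  apply/idP/idP => [BM|/hbd h].
    apply/hbd => a b ab; rewrite -cnt //; apply: card_le_rank (subsetIr _ _); apply: indep_sub BM (subsetIl _ _).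
  by apply: (indep_of_cint nc p_inj p_lt BE cB) => a b ab; rewrite cnt // h.
have rep_base (J : {set 'I_#|ground M|}) : #|J| = rank M (ground M) ->
    (s @: J \in indep M) = free [seq col j A | j <- enum J].
  move=> cJ; pose f (i : 'I_(rank M (ground M))) : 'I_#|ground M| := enum_val (cast_ord (esym cJ) i).
  have hf : {homo f : i j / (i < j)%N} by move=> i j ij; apply: enum_val_lt.
  have eJ : f @: [set: 'I__] = J.
    apply/setP => j; apply/imsetP/idP => [[k _ ->]|jJ]; first exact: enum_valP.
    exists (cast_ord cJ (enum_rank_in jJ j)) => //.
    by rewrite /f cast_ordK enum_rankK_in.
  by rewrite -[in LHS]eJ indep_det // -free_colsub ?eJ //; apply: increasing_inj.
exists s, A; split=> //; last by move=> f /hA[].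
have base_lift (I : {set T}) : I \in indep M -> exists K : {set 'I_#|ground M|},
    [/\ I \subset s @: K, s @: K \in indep M & #|K| = rank M (ground M)].
  move=> IM; have [B [BM IB BE cB]] := indep_extend IM (indep_ground IM).
  have eB : s @: (s @^-1: B) = B.
    apply/setP => x; apply/imsetP/idP => [[i + ->]|xB]; first by rewrite inE.
    have xE := subsetP BE x xB; exists (Ordinal (p_lt x xE)); rewrite ?inE sp //.
  by exists (s @^-1: B); split; rewrite ?eB // -cB -[in RHS]eB (card_imset _ s_inj).
move=> J; apply/idP/idP => [JM|fJ].
  have [K [JK KM cK]] := base_lift _ JM.
  apply: (@free_colS _ _ _ A J K); last by rewrite -rep_base.
  by apply/subsetP => j jJ; rewrite -(mem_imset _ _ s_inj) (subsetP JK) // imset_f.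
have [K [_ KM cK]] := base_lift _ (indep0 M).
have fK : free [seq col j A | j <- enum K] by rewrite -rep_base.
have [L [JL cL fL]] := free_col_extend fJ fK cK.
by apply: indep_sub (imsetS s JL); rewrite rep_base.
Qed.

Theorem theorem3p15 (R : realType) (T : finType) (t : nat) (M N : matroid T)
    (S : T -> {set T}) (hS : expansion_blocks t (ground M) S)
    (hN : is_expansion t S M N) :
  positroid R M <-> positroid R N.
Proof.
have [gN _ _] := hN; split=> /positroid_noncrossing[p p_inj nc].
  apply: noncrossing_positroid (noncrossing_expansion hS hN p_inj nc).
  by rewrite gN; apply: block_lexi_inj.
apply: noncrossing_positroid (noncrossing_of_expansion hS hN nc).
(* Each element lies in its own block, so the order found on [N] restricts to [M]. *)
have sub : {subset ground M <= ground N}.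
  by move=> e eE; rewrite gN; apply/bigcupP; exists e => //; have [mS _ _] := hS; apply: mS.
by move=> x y /sub xN /sub yN; apply: p_inj.
Qed.
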